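(* (1) Let $\alpha\in K[H]\setminus K$. Then $\mathrm{Cen}_{\mathbb{I}_1}(\alpha)=D_1\oplus C_\alpha\oplus C_\alpha^*$, where $C_\alpha:=\bigoplus_{i\ge1,j\ge0}\{Ke_{i+j,j}\mid j+1\text{ is a root of the polynomial }\tau^i(\alpha)-\alpha\}$, and $\mathrm{Cen}_{\mathbb{I}_1}(\alpha)^*=\mathrm{Cen}_{\mathbb{I}_1}(\alpha)$. In general, $\mathrm{Cen}_{\mathbb{I}_1}(\alpha)$ is a noncommutative, not left and not right Noetherian, not finitely generated algebra which is not a domain, as the following example shows: $\mathrm{Cen}_{\mathbb{I}_1}((H-\tfrac32)^2)=D_1\oplus Ke_{10}\oplus Ke_{01}$ (and this algebra has all these properties); but $\mathrm{Cen}_{\mathbb{I}_1}(H^k)=D_1$ is a commutative, not Noetherian, not finitely generated algebra which is not a domain, for all $k\ge1$; and $\mathrm{Cen}_{\mathbb{I}_1}(H-\tfrac32)=D_1\ne\mathrm{Cen}_{\mathbb{I}_1}((H-\tfrac32)^2)$. (2) Let $a\in\mathbb{I}_1$. Then $\dim_K(\mathrm{Cen}_F(a))<\infty$ iff $a\notin K[H]+F$. (3) $\mathrm{Cen}_{\mathbb{I}_1}(\partial^i)=K[\partial]$ and $\mathrm{Cen}_{\mathbb{I}_1}(\int^i)=K[\int]$ for all $i\ge1$. (4) $\mathrm{Cen}_{\mathbb{I}_1}(x^i)=K[x]$ for all $i\ge1$.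
   Context: $K$ is a field of characteristic zero. $\mathbb{I}_1$ is the subalgebra of $\mathrm{End}_K(K[x])$ generated by (multiplication by) $x$, $\partial=\frac{d}{dx}$ and $\int: x^n\mapsto \frac{x^{n+1}}{n+1}$. Put $H:=\partial x$ and $e_{ij}:=\int^i\partial^j-\int^{i+1}\partial^{j+1}$ ($i,j\ge0$); $F:=\bigoplus_{i,j\ge0}Ke_{ij}$ is an ideal of $\mathbb{I}_1$. $D_1:=K[H]\oplus\bigoplus_{i\ge0}Ke_{ii}$, a commutative subalgebra of $\mathbb{I}_1$. $\tau$ is the automorphism of $K[H]$ with $\tau(H)=H+1$. The involution $*$ of $\mathbb{I}_1$ is the $K$-algebra anti-automorphism with $\partial^*=\int$, $\int^*=\partial$, $H^*=H$; thus $e_{ij}^*=e_{ji}$. For $a\in\mathbb{I}_1$, $\mathrm{Cen}_{\mathbb{I}_1}(a)=\{b\in\mathbb{I}_1\mid ab=ba\}$ and $\mathrm{Cen}_F(a):=F\cap\mathrm{Cen}_{\mathbb{I}_1}(a)$. *)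

(* Defs.v *)
From HB Require Import structures.
From mathcomp Require Import all_boot all_algebra.
From mathcomp Require Import boolp classical_sets.

Set Implicit Arguments.
Unset Strict Implicit.
Unset Printing Implicit Defensive.

Import GRing.Theory.

Local Open Scope classical_set_scope.
Local Open Scope ring_scope.

Section LinearAlgebra.
Context {K : fieldType} {V : lmodType K}.

Definition lspan (G : set V) : set V :=
  smallest [set M : set V | GRing.submod_closed (mem M)] G.

Definition finite_dim (W : set V) : Prop :=
  exists s : seq V, W `<=` lspan [set` s].

Definition addsets (A B : set V) : set V := [set a + b | a in A & b in B].

(* W is the internal direct sum of the subspaces U i. *)
Definition is_dsum (I : finType) (U : I -> set V) (W : set V) : Prop :=
  W = [set \sum_i u i | u in [set u : I -> V | forall i, U i (u i)]] /\
  forall u : I -> V, (forall i, U i (u i)) ->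
    \sum_i u i = 0 -> forall i, u i = 0.

End LinearAlgebra.

Section Subalgebras.
Context {K : fieldType} {A : algType K}.

Definition gen_subalg (G : set A) : set A :=
  smallest [set M : set A | GRing.subalg_closed (mem M)] G.

(* K[a] *)
Definition polys_in (a : A) : set A := range (horner_alg a).

Definition centralizer (a : A) : set A := [set b | a * b = b * a].

(* The remaining definitions are meant for a subalgebra B of A. A left (right)
   ideal of B is automatically K-stable, since B contains K. *)
Definition commutative_alg (B : set A) : Prop :=
  forall a b, B a -> B b -> a * b = b * a.

Definition domain_alg (B : set A) : Prop :=
  forall a b, B a -> B b -> a * b = 0 -> a = 0 \/ b = 0.

Definition finitely_generated (B : set A) : Prop :=
  exists s : seq A, B = gen_subalg [set` s].

Definition left_ideal (B J : set A) : Prop :=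
  [/\ J `<=` B, J 0, (forall a b, J a -> J b -> J (a + b)) &
      forall r a, B r -> J a -> J (r * a)].

Definition right_ideal (B J : set A) : Prop :=
  [/\ J `<=` B, J 0, (forall a b, J a -> J b -> J (a + b)) &
      forall r a, B r -> J a -> J (a * r)].

Definition left_noetherian (B : set A) : Prop :=
  forall J : nat -> set A, (forall n, left_ideal B (J n)) ->
    (forall n, J n `<=` J n.+1) ->
  exists N, forall n, (N <= n)%N -> J n = J N.

Definition right_noetherian (B : set A) : Prop :=
  forall J : nat -> set A, (forall n, right_ideal B (J n)) ->
    (forall n, J n `<=` J n.+1) ->
  exists N, forall n, (N <= n)%N -> J n = J N.

End Subalgebras.

(* The algebra End_K(K[x]), with composition as product. *)
Definition polyEnd (K : fieldType) := {linear {poly K} -> {poly K}}.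

Section PolyEnd.
Variable K : fieldType.
Implicit Types (f g h : polyEnd K) (c : K) (p : {poly K}).

HB.instance Definition _ := gen_eqMixin (polyEnd K).
HB.instance Definition _ := gen_choiceMixin (polyEnd K).

Definition papp f : {poly K} -> {poly K} := f.

Lemma polyEndP f g : papp f =1 papp g -> f = g.
Proof.
have irr (h : {poly K} -> {poly K}) (c c' : GRing.Linear.axioms_ *:%R h) : c = c'.
  move: c c' => [[a] [s]] [[a'] [s']].
  by rewrite (Prop_irrelevance a a') (Prop_irrelevance s s').
move: f g => [f cf] [g cg] /funext; rewrite /papp /= => fg.
by case: _ / fg in cg *; rewrite (irr _ cf cg).
Qed.

Definition pe0 : polyEnd K := \0.
Definition peN f : polyEnd K := \- (f : {linear _ -> _}).
Definition peD f g : polyEnd K := (f : {linear _ -> _}) \+ (g : {linear _ -> _}).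
Definition pe1 : polyEnd K := idfun.
Definition peM f g : polyEnd K := (f : {linear _ -> _}) \o (g : {linear _ -> _}).
Definition peZ c f : polyEnd K := c \*: (f : {linear _ -> _}).

Lemma peDA : associative peD.
Proof. by move=> f g h; apply: polyEndP => p; exact: addrA. Qed.
Lemma peDC : commutative peD.
Proof. by move=> f g; apply: polyEndP => p; exact: addrC. Qed.
Lemma pe0D : left_id pe0 peD.
Proof. by move=> f; apply: polyEndP => p; exact: add0r. Qed.
Lemma peND : left_inverse pe0 peN peD.
Proof. by move=> f; apply: polyEndP => p; exact: addNr. Qed.

HB.instance Definition _ := GRing.isZmodule.Build (polyEnd K) peDA peDC pe0D peND.

Lemma peMA : associative peM.
Proof. by move=> f g h; exact: polyEndP. Qed.
Lemma pe1M : left_id pe1 peM.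
Proof. by move=> f; exact: polyEndP. Qed.
Lemma peM1 : right_id pe1 peM.
Proof. by move=> f; exact: polyEndP. Qed.
Lemma peMDl : left_distributive peM +%R.
Proof. by move=> f g h; exact: polyEndP. Qed.
Lemma peMDr : right_distributive peM +%R.
Proof. by move=> f g h; apply: polyEndP => p; exact: raddfD. Qed.
Lemma pe1_neq0 : pe1 != 0 :> polyEnd K.
Proof.
apply/eqP => /(congr1 (fun f => papp f 1)) /eqP; exact/negP/oner_neq0.
Qed.

HB.instance Definition _ := GRing.Zmodule_isNzRing.Build (polyEnd K)
  peMA pe1M peM1 peMDl peMDr pe1_neq0.

Lemma peZA c d f : peZ c (peZ d f) = peZ (c * d) f.
Proof. by apply: polyEndP => p; exact: scalerA. Qed.
Lemma pe1Z : left_id 1 peZ.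
Proof. by move=> f; apply: polyEndP => p; exact: scale1r. Qed.
Lemma peZDr : right_distributive peZ +%R.
Proof. by move=> c f g; apply: polyEndP => p; exact: scalerDr. Qed.
Lemma peZDl f : {morph peZ^~ f : c d / c + d}.
Proof. by move=> c d; apply: polyEndP => p; exact: scalerDl. Qed.

HB.instance Definition _ := GRing.Zmodule_isLmodule.Build K (polyEnd K)
  peZA pe1Z peZDr peZDl.

Lemma peZAl c f g : c *: (f * g) = (c *: f) * g.
Proof. exact: polyEndP. Qed.

HB.instance Definition _ := GRing.Lmodule_isLalgebra.Build K (polyEnd K) peZAl.

Lemma peZAr c f g : c *: (f * g) = f * (c *: g).
Proof. by apply: polyEndP => p; rewrite /papp /= linearZ. Qed.

HB.instance Definition _ := GRing.Lalgebra_isAlgebra.Build K (polyEnd K) peZAr.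

Lemma pappM f g p : papp (f * g) p = papp f (papp g p). Proof. by []. Qed.
Lemma pappD f g p : papp (f + g) p = papp f p + papp g p. Proof. by []. Qed.
Lemma pappN f p : papp (- f) p = - papp f p. Proof. by []. Qed.
Lemma pappZ c f p : papp (c *: f) p = c *: papp f p. Proof. by []. Qed.
Lemma papp1 p : papp 1 p = p. Proof. by []. Qed.
Lemma papp0 p : papp 0 p = 0. Proof. by []. Qed.

Definition mulX_fun p : {poly K} := 'X * p.

Lemma mulX_linear : linear mulX_fun.
Proof. by move=> c p q; rewrite /mulX_fun mulrDr scalerAr. Qed.

HB.instance Definition _ :=
  GRing.isLinear.Build K {poly K} {poly K} *:%R mulX_fun mulX_linear.

Definition int_fun p : {poly K} :=
  \sum_(n < size p) (p`_n / n.+1%:R) *: 'X^(n.+1).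

Lemma coef_int_fun p n :
  (int_fun p)`_n = if n is m.+1 then p`_m / n%:R else 0.
Proof.
rewrite /int_fun coef_sum; case: n => [|m].
  by rewrite big1 // => i _; rewrite coefZ coefXn mulr0.
under eq_bigr do rewrite coefZ coefXn eqSS.
case: (ltnP m (size p)) => [lt_mp | le_pm].
  rewrite (bigD1 (Ordinal lt_mp)) //= eqxx mulr1 big1 ?addr0 // => i ne_im.
  case: eqVneq => [eq_mi|]; last by rewrite mulr0.
  by case/eqP: ne_im; exact/val_inj.
rewrite nth_default // mul0r big1 // => i _.
by rewrite gtn_eqF ?mulr0 // (leq_trans (ltn_ord i)).
Qed.

Lemma int_linear : linear int_fun.
Proof.
move=> c p q; apply/polyP => n; rewrite coefD coefZ !coef_int_fun.
case: n => [|n]; first by rewrite mulr0 addr0.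
by rewrite coefD coefZ mulrDl mulrA.
Qed.

HB.instance Definition _ :=
  GRing.isLinear.Build K {poly K} {poly K} *:%R int_fun int_linear.

Definition xE : polyEnd K := mulX_fun.
Definition dE : polyEnd K := (deriv : {poly K} -> {poly K}).
Definition intE : polyEnd K := int_fun.

Definition I1_set : set (polyEnd K) :=
  gen_subalg ([set xE] `|` [set dE] `|` [set intE]).
Definition I1_pred : pred (polyEnd K) := mem I1_set.

Lemma gen_subalg_closed (A : algType K) (G : set A) :
  GRing.subalg_closed (mem (gen_subalg G)).
Proof.
split.
- by apply/mem_set => M [/= [M1 _ _] _]; exact/set_mem.
- move=> c u v /set_mem Gu /set_mem Gv; apply/mem_set => M GM.
  by have [[_ ML _] _] := GM; apply/set_mem/ML; apply/mem_set; [exact: Gu | exact: Gv].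
- move=> u v /set_mem Gu /set_mem Gv; apply/mem_set => M GM.
  by have [[_ _ MM] _] := GM; apply/set_mem/MM; apply/mem_set; [exact: Gu | exact: Gv].
Qed.

HB.instance Definition _ := GRing.isSubalgClosed.Build K (polyEnd K) I1_pred
  (gen_subalg_closed _).


Lemma sub_gen_subalg (A : algType K) (G : set A) : G `<=` gen_subalg G.
Proof. by move=> a Ga M [_]; exact. Qed.

Lemma xE_I1 : I1_pred xE.
Proof. by apply/mem_set; apply: sub_gen_subalg; left; left. Qed.
Lemma dE_I1 : I1_pred dE.
Proof. by apply/mem_set; apply: sub_gen_subalg; left; right. Qed.
Lemma intE_I1 : I1_pred intE.
Proof. by apply/mem_set; apply: sub_gen_subalg; right. Qed.

End PolyEnd.

Record I1 (K : fieldType) := MkI1 { I1val : polyEnd K; _ : I1_pred I1val }.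

HB.instance Definition _ (K : fieldType) := [isSub for @I1val K].
HB.instance Definition _ (K : fieldType) := [Choice of I1 K by <:].
HB.instance Definition _ (K : fieldType) :=
  [SubChoice_isSubAlgebra of I1 K by <:].

Section I1.
Variable K : fieldType.

Definition Ix : I1 K := MkI1 (xE_I1 K).
Definition Ider : I1 K := MkI1 (dE_I1 K).
Definition Iint : I1 K := MkI1 (intE_I1 K).
Definition IH : I1 K := Ider * Ix.

Definition e (i j : nat) : I1 K :=
  Iint ^+ i * Ider ^+ j - Iint ^+ i.+1 * Ider ^+ j.+1.

Definition scalars : set (I1 K) := range (in_alg (I1 K)).

(* e i j is linearly independent, see e_free, so that the spans of the e i j
   below are the direct sums of the lines spanned by these elements; the sum
   defining D1 is direct by polys_in_IH_F. *)
Definition F : set (I1 K) := lspan [set e ij.1 ij.2 | ij in setT].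

Definition D1 : set (I1 K) :=
  addsets (polys_in IH) (lspan (range (fun i => e i i))).

(* The algebra K[H] is identified with {poly K} by means of p |-> p(H), which
   is injective, see horner_IH_inj. *)
Definition tau (p : {poly K}) : {poly K} := p \Po ('X + 1).

Definition C_ (p : {poly K}) : set (I1 K) :=
  lspan [set e (ij.1 + ij.2) ij.2 | ij in
    [set ij : nat * nat | (1 <= ij.1)%N /\
       root (iter ij.1 tau p - p) (ij.2.+1)%:R]].

Definition Cen_F (a : I1 K) : set (I1 K) := F `&` centralizer a.

Definition is_involution (s : I1 K -> I1 K) : Prop :=
  [/\ linear s, s 1 = 1, (forall a b, s (a * b) = s b * s a), involutive s &
      [/\ s Ider = Iint, s Iint = Ider & s IH = IH]].

(* Well defined in characteristic 0: see star_is_involution and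
   is_involution_uniq. *)
Definition star : I1 K -> I1 K :=
  xget (idfun : I1 K -> I1 K) is_involution.

End I1.

Arguments scalars : clear implicits.
Arguments F : clear implicits.
Arguments D1 : clear implicits.
Arguments star : clear implicits.

Section Facts.
Variable K : fieldType.
Implicit Types (a b : I1 K) (p q : {poly K}).

Let act a p : {poly K} := papp (val a) p.

Lemma I1_ind (P : I1 K -> Prop) :
  P 1 -> (forall c a b, P a -> P b -> P (c *: a + b)) ->
  (forall a b, P a -> P b -> P (a * b)) ->
  P (Ix K) -> P (Ider K) -> P (Iint K) -> forall a, P a.
Proof.
move=> P1 PL PM Px Pd Pi a.
suff : [set f | exists2 b, val b = f & P b] (val a).
  by case=> b /val_inj ->.
have /set_mem : I1_pred (val a) := valP a.
apply; split; last first.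
  by move=> f [[->|->]|->]; [exists (Ix K)|exists (Ider K)|exists (Iint K)].
split; first by apply/mem_set; exists 1.
- move=> c _ _ /set_mem[f <- Pf] /set_mem[g <- Pg]; apply/mem_set.
  by exists (c *: f + g); [|exact: PL].
- move=> _ _ /set_mem[f <- Pf] /set_mem[g <- Pg]; apply/mem_set.
  by exists (f * g); [|exact: PM].
Qed.

Lemma polyEnd_ext (f g : polyEnd K) :
  (forall n, papp f 'X^n = papp g 'X^n) -> f = g.
Proof.
move=> fg; apply: polyEndP => p.
rewrite -[p]coefK poly_def /papp !linear_sum; apply: eq_bigr => i _.
by rewrite !linearZ; congr (_ *: _); exact: fg.
Qed.

Lemma act_d p : act (Ider K) p = p^`(). Proof. by []. Qed.
Lemma act_x p : act (Ix K) p = 'X * p. Proof. by []. Qed.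

Lemma act_int_Xn n : act (Iint K) 'X^n = n.+1%:R^-1 *: 'X^(n.+1).
Proof.
apply/polyP => i; rewrite /act /papp /= coef_int_fun coefZ.
case: i => [|i]; first by rewrite coefXn mulr0.
by rewrite !coefXn eqSS; case: eqVneq => [->|_]; rewrite ?mul1r ?mulr1 ?mul0r ?mulr0.
Qed.

Lemma actM a b p : act (a * b) p = act a (act b p). Proof. by []. Qed.
Lemma actB a b p : act (a - b) p = act a p - act b p. Proof. by []. Qed.
Lemma actD a b p : act (a + b) p = act a p + act b p. Proof. by []. Qed.
Lemma actZ c a p : act (c *: a) p = c *: act a p. Proof. by []. Qed.
Lemma act1 p : act 1 p = p. Proof. by []. Qed.

Lemma act_linZ c a p : act a (c *: p) = c *: act a p.
Proof. by rewrite /act /papp linearZ. Qed.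

Lemma act_lin0 a : act a 0 = 0.
Proof. by rewrite /act /papp linear0. Qed.

Lemma act_sum (I : Type) (r : seq I) (f : I -> I1 K) p :
  act (\sum_(i <- r) f i) p = \sum_(i <- r) act (f i) p.
Proof.
by elim: r => [|i r IHr]; rewrite ?big_nil // !big_cons -IHr.
Qed.

Lemma act_H_Xn n : act (IH K) 'X^n = n.+1%:R *: 'X^n.
Proof. by rewrite actM act_d act_x -exprS derivXn scaler_nat. Qed.

Lemma act_horner_H p n : act (horner_alg (IH K) p) 'X^n = p.[n.+1%:R] *: 'X^n.
Proof.
elim/poly_ind: p => [|p c IHp]; first by rewrite rmorph0 horner0 scale0r.
rewrite rmorphD rmorphM /= horner_algC horner_algX hornerMXaddC.
rewrite actD actM actZ act1 act_H_Xn act_linZ IHp scalerA -scalerDl.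
by rewrite [_ * n.+1%:R]mulrC.
Qed.

Hypothesis char0 : [pchar K] =i pred0.

Let natK_eq0 n : (n%:R == 0 :> K) = (n == 0%N).
Proof. exact: (pcharf0P K).1. Qed.

Let natK_neq0 n : n.+1%:R != 0 :> K.
Proof. by rewrite natK_eq0. Qed.

Let factK_neq0 n : n`!%:R != 0 :> K.
Proof. by rewrite natK_eq0 -lt0n fact_gt0. Qed.

Lemma polyK_eq0 p N : (forall n, (N <= n)%N -> p.[n.+1%:R] = 0) -> p = 0.
Proof.
move=> p0; apply/eqP/contraT => nz_p.
pose rs : seq K := [seq n.+1%:R | n <- iota N (size p)].
have := @max_poly_roots _ p rs nz_p; rewrite size_map size_iota ltnn; apply.
  by apply/allP => _ /mapP[n /[!mem_iota] /andP[leNn _] ->]; apply/eqP/p0.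
rewrite map_inj_uniq ?iota_uniq // => m n.
have inj (i j : nat) : (i <= j)%N -> i.+1%:R = j.+1%:R :> K -> i = j.
  move=> le_ij /esym/eqP; rewrite -subr_eq0 -natrB // subSS natK_eq0 => /eqP.
  by move=> /eqP; rewrite subn_eq0 => le_ji; apply/eqP; rewrite eqn_leq le_ij.
by case/orP: (leq_total m n) => le_mn ?; [|symmetry]; exact: inj.
Qed.

Lemma horner_IH_inj : injective (horner_alg (IH K)).
Proof.
move=> p q Epq; apply/eqP; rewrite -subr_eq0; apply/eqP/(@polyK_eq0 _ 0) => n _.
have /eqP: act (horner_alg (IH K) p) 'X^n = act (horner_alg (IH K) q) 'X^n.
  by rewrite Epq.
rewrite !act_horner_H -subr_eq0 -scalerBl scaler_eq0 -size_poly_eq0 size_polyXn.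
by rewrite orbF hornerD hornerN => /eqP.
Qed.

Let dX n : {poly K} := n`!%:R^-1 *: 'X^n.

Let dX_neq0 n : dX n != 0.
Proof.
by rewrite scaler_eq0 invr_eq0 (negPf (factK_neq0 n)) -size_poly_eq0 size_polyXn.
Qed.

Let act_int_dX n k : act (Iint K ^+ k) (dX n) = dX (n + k).
Proof.
elim: k => [|k IHk]; first by rewrite expr0 act1 addn0.
rewrite exprS actM IHk act_linZ act_int_Xn scalerA addnS /dX factS.
by rewrite natrM invfM mulrC.
Qed.

Let act_d_dX n k : act (Ider K ^+ k) (dX n) = if (k <= n)%N then dX (n - k) else 0.
Proof.
elim: k n => [|k IHk] n; first by rewrite expr0 act1 subn0.
rewrite exprSr actM act_d derivZ derivXn.
case: n => [|n]; first by rewrite scaler0 act_lin0.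
rewrite ltnS subSS -IHk /= -scaler_nat scalerA factS natrM invfM mulrAC.
by rewrite mulVf // mul1r.
Qed.

Lemma act_e i j n : act (e K i j) (dX n) = if n == j then dX i else 0.
Proof.
rewrite actB !actM !act_d_dX; case: (ltngtP n j) => [lt_nj|lt_jn|->].
- by rewrite !act_lin0 subrr.
- by rewrite !act_int_dX addnS -addSn subnSK // subrr.
- by rewrite act_int_dX subnn act_lin0 subr0.
Qed.

Lemma e_free (s : seq (nat * nat)) (c : nat * nat -> K) : uniq s ->
  \sum_(ij <- s) c ij *: e K ij.1 ij.2 = 0 -> {in s, forall ij, c ij = 0}.
Proof.
move=> Us s0 [i j] sij.
have /(congr1 (fun q : {poly K} => q`_i * i`!%:R)) :
    act (\sum_(ij <- s) c ij *: e K ij.1 ij.2) (dX j) = 0.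
  by rewrite s0.
rewrite act_sum coef0 mul0r coef_sum (bigD1_seq _ sij Us) /= big1_seq => [|[k l]].
  rewrite actZ act_e eqxx addr0 !coefZ coefXn eqxx mulr1.
  by rewrite -mulrA mulVf // mulr1.
case/andP=> ne_kl _; rewrite actZ act_e /=.
case: eqVneq => [Ejl|_]; last by rewrite scaler0 coef0.
rewrite !coefZ coefXn; case: eqVneq => [Eik|_]; last by rewrite !mulr0.
by case/eqP: ne_kl; rewrite Eik Ejl.
Qed.

Lemma polys_in_IH_F : polys_in (IH K) `&` F K = [set 0].
Proof.
apply/seteqP; split=> [_ [[p _ <-] Fp]|_ ->]; last first.
  split; first by exists 0; rewrite ?rmorph0.
  by move=> M [[M0 _] _]; exact: set_mem.
have {Fp} [N pN]: [set a | exists N, forall n, (N <= n)%N -> act a (dX n) = 0]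
                    (horner_alg (IH K) p).
  apply: Fp; split=> [|_ [[i j] _ <-]]; last first.
    by exists j.+1 => n lt_jn; rewrite act_e gtn_eqF.
  split=> [|c u v]; first by apply/mem_set; exists 0.
  move=> /set_mem[N uN] /set_mem[M vM]; apply/mem_set; exists (maxn N M) => n.
  rewrite geq_max => /andP[/uN un0 /vM vn0].
  by rewrite actD actZ un0 vn0 scaler0 addr0.
suff -> : p = 0 by rewrite rmorph0.
apply: (@polyK_eq0 _ N) => n /pN /eqP; rewrite act_linZ act_horner_H scalerA mulrC.
by rewrite -scalerA scaler_eq0 (negPf (dX_neq0 n)) orbF => /eqP.
Qed.

(* The transpose with respect to the basis x^n / n!. *)
Let adj a b := forall i j,
  (act a 'X^i)`_j * j`!%:R ^+ 2 = (act b 'X^j)`_i * i`!%:R ^+ 2.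

Let fact2_neq0 n : n`!%:R ^+ 2 != 0 :> K.
Proof. exact: expf_neq0. Qed.

Let adj_sym a b : adj a b -> adj b a.
Proof. by move=> ab i j; rewrite ab. Qed.

Let adj_uniq a b b' : adj a b -> adj a b' -> b = b'.
Proof.
move=> ab ab'; apply/val_inj/polyEnd_ext => j; apply/polyP => i.
by apply: (mulIf (fact2_neq0 i)); rewrite -[LHS]ab -[RHS]ab'.
Qed.

Let act_coef a p n N : (size p <= N)%N ->
  (act a p)`_n = \sum_(k < N) p`_k * (act a 'X^k)`_n.
Proof.
move=> le_pN; have {1}-> : p = \sum_(k < N) p`_k *: 'X^k.
  rewrite -poly_def; apply/polyP => i; rewrite coef_poly; case: ltnP => // leNi.
  by rewrite nth_default // (leq_trans le_pN).
rewrite /act /papp linear_sum coef_sum; apply: eq_bigr => k _.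
by rewrite linearZ coefZ.
Qed.

Let adjM a b a' b' : adj a b -> adj a' b' -> adj (a * a') (b' * b).
Proof.
move=> ab ab' i j; rewrite !actM.
pose N := maxn (size (act a' 'X^i)) (size (act b 'X^j)).
rewrite (@act_coef a _ _ N) ?leq_maxl // (@act_coef b' _ _ N) ?leq_maxr //.
rewrite !mulr_suml; apply: eq_bigr => k _.
by rewrite -!mulrA ab -ab' mulrCA.
Qed.

Let adjL c a b a' b' : adj a b -> adj a' b' -> adj (c *: a + a') (c *: b + b').
Proof.
move=> ab ab' i j.
have E u v q : act (c *: u + v) q = c *: act u q + act v q by [].
by rewrite !E !coefD !coefZ !mulrDl -!mulrA ab ab'.
Qed.

Let adj1 : adj 1 1.
Proof.
by move=> i j; rewrite !act1 !coefXn eq_sym; case: eqVneq => [->|]; rewrite ?mul0r.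
Qed.

Let adj_d_int : adj (Ider K) (Iint K).
Proof.
move=> i j; rewrite act_d derivXn act_int_Xn -scaler_nat !coefZ !coefXn.
case: i => [|i]; first by rewrite !mul0r mulr0 mul0r.
rewrite eqSS [i == j]eq_sym; case: eqVneq => [->|_]; last by rewrite !mulr0 !mul0r.
rewrite !mulr1 factS natrM exprMn [i.+1%:R ^+ 2]expr2 !mulrA.
by rewrite mulVf // mul1r.
Qed.

Lemma IxE : Ix K = Iint K * IH K.
Proof.
apply/val_inj/polyEnd_ext => n; rewrite -!/(act _ _) actM act_H_Xn act_linZ.
by rewrite act_int_Xn scalerA mulfV // scale1r act_x -exprS.
Qed.

Let adj_H : adj (IH K) (IH K).
Proof.
move=> i j; rewrite !act_H_Xn !coefZ !coefXn eq_sym.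
by case: eqVneq => [->|_]; rewrite // !mulr0 !mul0r.
Qed.

Let adj_ex a : exists b, adj a b.
Proof.
elim/I1_ind: a.
- by exists 1; exact: adj1.
- by move=> c a b [a' aa'] [b' bb']; exists (c *: a' + b'); exact: adjL.
- by move=> a b [a' aa'] [b' bb']; exists (b' * a'); exact: adjM.
- by exists (IH K * Ider K); rewrite IxE; apply: adjM; [exact: adj_sym|].
- by exists (Iint K); exact: adj_d_int.
- by exists (Ider K); exact: adj_sym.
Qed.

Lemma star_is_involution : is_involution (star K).
Proof.
apply: xgetPex; exists (fun a => projT1 (cid (adj_ex a))).
have sP a : adj a (projT1 (cid (adj_ex a))) by case: cid.
split=> [c a b||a b|a|].
- by apply: adj_uniq (sP _) _; exact: adjL.
- by apply: adj_uniq (sP _) _; exact: adj1.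
- by apply: adj_uniq (sP _) _; exact: adjM.
- by apply: adj_uniq (sP _) _; exact/adj_sym/sP.
- split; apply: adj_uniq (sP _) _; [exact: adj_d_int| |exact: adj_H].
  exact/adj_sym/adj_d_int.
Qed.

Lemma is_involution_uniq s : is_involution s -> s = star K.
Proof.
have [tL t1 tM _ [td ti tH]] := star_is_involution.
move=> [sL s1 sM _ [sd si sH]]; apply/funext => a.
elim/I1_ind: a.
- by rewrite s1 t1.
- by move=> c a b Ea Eb; rewrite sL tL Ea Eb.
- by move=> a b Ea Eb; rewrite sM tM Ea Eb.
- by rewrite IxE sM tM si ti sH tH.
- by rewrite sd td.
- by rewrite si ti.
Qed.

End Facts.

(* Main.v *)
Require Import Defs.
From mathcomp Require Import all_boot all_algebra.
From mathcomp Require Import boolp classical_sets.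
From mathcomp Require Import zify.

Set Implicit Arguments.
Unset Strict Implicit.
Unset Printing Implicit Defensive.

Import GRing.Theory.
Local Open Scope classical_set_scope.
Local Open Scope ring_scope.

(** Everything is read off the matrix of an operator in the basis x^n/n! of K[x],
in which \partial and \int are the two shifts, e_ij is a matrix unit, p(H) is the
diagonal matrix with entries p(j+1), and the involution * is transposition
([entry_star]). By the standard form [I1_standard_form], I_1 is spanned by the
elements \int^k p(H), p(H) \partial^k and e_ij; hence the matrix of an element of
I_1 has finitely many nonzero diagonals ([entry_banded]), and each diagonal is
eventually polynomial in the position ([entry_eventually_poly]). The elements of
F are the finite matrices.

(1) b commutes with p(H) exactly when (p(i+1) - p(j+1)) b_ij = 0 for all i, j.
Off the main diagonal the first factor is a nonzero polynomial in the position
when p is not constant, so that each such diagonal of b is eventually zero: b is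
in K[H] + F, and the remaining finitely many entries b_ij sit at places where
p(i+1) = p(j+1) ([cen_evH_dsum]). All the e_nn belong to such a centralizer.
Those of its elements that vanish on all but the first n columns (or rows) form a
strictly increasing chain of left (or right) ideals, and a finite set of elements
of K[H] + F generates only elements that beyond a fixed column are the diagonal
of a polynomial, which excludes e_nn for n large ([not_finitely_generated]).

(2) If a is in K[H] + F then a commutes with almost all the e_nn. Otherwise some
diagonal of a away from the main one is not eventually zero; up to transposing, it
is below the main diagonal, and the lowest such diagonal, at distance d, has
nonzero entries from some place N on. Then a raises degrees by exactly d from N
on. For f in F commuting with a this forces the rows of f from N on to vanish, and
makes f determined by its first N + d columns: finitely many linear forms separate
the points of Cen_F(a) ([Cen_F_finite_leading]).

(3), (4) Commuting with the i-th power of a shift makes the entries of b periodic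
along each diagonal. Since they are also eventually polynomial (in the basis x^n,
eventually rational), they are constant ([periodic_eventually_rational]); so b
commutes with the shift itself, and can be written as a polynomial in it. The case
of \int follows from that of \partial by transposition. *)

(** * Spans, direct sums and finite dimension *)

Section Span.
Context {K : fieldType} {V : lmodType K}.
Implicit Types (G : set V) (u v : V) (c : K).

Lemma lspan_ind G (P : V -> Prop) :
  P 0 -> (forall c u v, P u -> P v -> P (c *: u + v)) ->
  (forall u, G u -> P u) -> forall u, lspan G u -> P u.
Proof.
move=> P0 PL PG u; apply; split=> //; split; first exact/mem_set.
by move=> c v w /set_mem Pv /set_mem Pw; apply/mem_set/PL.
Qed.

Lemma sub_lspan G : G `<=` lspan G.
Proof. by move=> u Gu M [_]; exact. Qed.

Lemma lspan0 G : lspan G 0.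
Proof. by move=> M [[/set_mem M0 _] _]. Qed.

Lemma lspanL G c u v : lspan G u -> lspan G v -> lspan G (c *: u + v).
Proof.
move=> Gu Gv M GM; have [[_ ML] _] := GM.
by apply/set_mem/ML; apply/mem_set; [exact: Gu | exact: Gv].
Qed.

Lemma lspanD G u v : lspan G u -> lspan G v -> lspan G (u + v).
Proof. by rewrite -[X in X + _]scale1r; exact: lspanL. Qed.

Lemma lspanZ G c u : lspan G u -> lspan G (c *: u).
Proof. by move=> Gu; rewrite -[_ *: _]addr0; apply: lspanL => //; exact: lspan0. Qed.

Lemma lspan_sum G (I : Type) (r : seq I) (P : pred I) (f : I -> V) :
  (forall i, P i -> lspan G (f i)) -> lspan G (\sum_(i <- r | P i) f i).
Proof.
by move=> Gf; elim/big_ind: _ => //; [exact: lspan0 | exact: lspanD].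
Qed.

Lemma lspan_mono G G' : G `<=` G' -> lspan G `<=` lspan G'.
Proof.
move=> GG' u; elim/lspan_ind => [|c v w|v /GG'].
- exact: lspan0.
- exact: lspanL.
- exact: sub_lspan.
Qed.

End Span.

Section IsDsum3.
Context {K : fieldType} {V : lmodType K}.

(** Trades the families over a three-element index type in the definition of a
direct sum for explicit triples. *)
Lemma is_dsum3 (A B C W : set V) :
  (forall w, W w <-> exists a b c, [/\ A a, B b, C c & w = a + b + c]) ->
  (forall a b c, A a -> B b -> C c -> a + b + c = 0 -> [/\ a = 0, b = 0 & c = 0]) ->
  is_dsum (tnth [tuple A; B; C]) W.
Proof.
move=> WE free0.
have sum3 (u : 'I_3 -> V) : \sum_i u i = u (inord 0) + u (inord 1) + u (inord 2).
  rewrite !big_ord_recl big_ord0 addr0 addrA.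
  by congr (u _ + u _ + u _); apply: val_inj; rewrite /= inordK.
have mem3 (u : 'I_3 -> V) : (forall i, tnth [tuple A; B; C] i (u i)) <->
    [/\ A (u (inord 0)), B (u (inord 1)) & C (u (inord 2))].
  split=> [uU|[u0 u1 u2] i].
    have := uU (inord 2); have := uU (inord 1); have := uU (inord 0).
    by rewrite !(tnth_nth set0) /= !inordK.
  have -> : i = inord i by rewrite inord_val.
  by rewrite (tnth_nth set0) /= inordK //; case: i => -[|[|[|//]]] ?.
split=> [|u /mem3[u0 u1 u2]].
  apply/seteqP; split=> [w /WE[a [b [c [Aa Bb Cc ->]]]]|_ [u /mem3[u0 u1 u2] <-]].
    exists (fun i : 'I_3 => nth 0 [:: a; b; c] i); last by rewrite sum3 !inordK.
    by apply/mem3; rewrite !inordK.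
  by apply/WE; exists (u (inord 0)), (u (inord 1)), (u (inord 2)); rewrite sum3.
rewrite sum3 => /free0[] // z0 z1 z2 i; have -> : i = inord i by rewrite inord_val.
by case: i => -[|[|[|//]]] ?.
Qed.

End IsDsum3.

Section FiniteDim.
Context {K : fieldType} {V : lmodType K}.
Implicit Types (W : set V) (s : seq V) (phi : nat -> V -> K).

Lemma lspan_seq s u : lspan [set` s] u ->
  exists c : 'I_(size s) -> K, u = \sum_i c i *: s`_i.
Proof.
move: u; apply: lspan_ind => [|c u v [cu ->] [cv ->]|u /= su].
- by exists (fun=> 0); rewrite big1 // => i _; rewrite scale0r.
- exists (fun i => c * cu i + cv i); rewrite scaler_sumr -big_split.
  by apply: eq_bigr => i _; rewrite scalerA scalerDl.
- have lt_us : (index u s < size s)%N by rewrite index_mem.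
  exists (fun i => (i == Ordinal lt_us)%:R).
  rewrite (bigD1 (Ordinal lt_us)) //= eqxx scale1r nth_index // big1 ?addr0 //.
  by move=> i /negPf->; rewrite scale0r.
Qed.

(** If W were spanned by s, the identity matrix of size m + 1, for m the length of
s, would factor through dimension m. *)
Lemma biorthogonal_infinite W phi (w : nat -> V) :
  (forall n c u v, phi n (c *: u + v) = c * phi n u + phi n v) ->
  (forall n, W (w n)) -> (forall m n, phi m (w n) = (m == n)%:R) ->
  ~ finite_dim W.
Proof.
move=> phiL Ww phiw [s Ws]; pose m := size s.
have phi0 n : phi n 0 = 0.
  by have /eqP := phiL n (-1) 0 0; rewrite scaler0 addr0 mulN1r addNr => /eqP.
have phi_sum n (c : 'I_m -> K) :
    phi n (\sum_i c i *: s`_i) = \sum_i c i * phi n s`_i.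
  elim/big_rec2: _ => [|i y x _ <-]; first exact: phi0.
  by rewrite phiL.
have [c wc] := choice (fun n => lspan_seq (Ws _ (Ww n))).
pose A : 'M[K]_(m.+1, m) := \matrix_(i, j) c i j.
pose B : 'M[K]_(m, m.+1) := \matrix_(i, j) phi j s`_i.
have AB : A *m B = 1%:M.
  apply/matrixP => i j; rewrite !mxE eq_sym -(phiw j i) wc phi_sum.
  by apply: eq_bigr => k _; rewrite !mxE.
have := mxrankM_maxl A B; rewrite AB mxrank1 => /leq_trans/(_ (rank_leq_col A)).
by rewrite ltnn.
Qed.

(** Induction on the number of forms: either the last one vanishes on W, or W is
spanned by its kernel and one further vector. *)
Lemma finite_dim_functionals m W phi :
  (forall n c u v, phi n (c *: u + v) = c * phi n u + phi n v) ->
  (forall c u v, W u -> W v -> W (c *: u + v)) ->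
  (forall w, W w -> (forall n, (n < m)%N -> phi n w = 0) -> w = 0) ->
  finite_dim W.
Proof.
move=> phiL; elim: m W => [|m ihyp] W WL W0.
  by exists [::] => w /W0 -> //; exact: lspan0.
pose W' := [set w | W w /\ phi m w = 0].
have [s Ws] : finite_dim W'.
  apply: ihyp => [c u v [Wu u0] [Wv v0]|w [Ww wm] w0].
    by split; [exact: WL | rewrite phiL u0 v0 mulr0 addr0].
  by apply: W0 => // n; rewrite ltnS leq_eqVlt => /predU1P[->//|]; exact: w0.
have [[v [Wv nzv]]|noW] := pselect (exists v, W v /\ phi m v != 0); last first.
  exists s => w Ww; apply: Ws; split=> //; apply/eqP/contraT => nz.
  by case: noW; exists w.
exists (v :: s) => w Ww.
have W'w : W' (- (phi m w / phi m v) *: v + w).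
  by split; [exact: WL | rewrite phiL mulNr mulfVK // addNr].
have -> : w = (phi m w / phi m v) *: v + (- (phi m w / phi m v) *: v + w).
  by rewrite addrA -scalerDl subrr scale0r add0r.
apply: lspanL; first by apply: sub_lspan => /=; rewrite inE eqxx.
by apply: lspan_mono (Ws _ W'w) => x /= sx; rewrite inE sx orbT.
Qed.

End FiniteDim.

(** * Matrix entries in the basis of divided powers *)

Section Entries.
Context {K : fieldType}.
Implicit Types (a b : I1 K) (p q : {poly K}) (c : K).

(** Divided powers turn \partial and \int into shifts without coefficients. *)
Definition dpow n : {poly K} := n`!%:R^-1 *: 'X^n.

Definition entry a i j : K := (papp (val a) (dpow j))`_i * i`!%:R.

Lemma entryE a i j : entry a i j = (papp (val a) 'X^j)`_i * (i`!%:R / j`!%:R).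
Proof. by rewrite /entry /papp linearZ coefZ [_^-1 * _]mulrC mulrAC mulrA. Qed.

Lemma entryD a b i j : entry (a + b) i j = entry a i j + entry b i j.
Proof. by rewrite /entry -mulrDl -coefD. Qed.

Lemma entryZ c a i j : entry (c *: a) i j = c * entry a i j.
Proof. by rewrite /entry mulrA -coefZ. Qed.

Lemma entry0 i j : entry 0 i j = 0.
Proof. by rewrite -[0](scale0r 0) entryZ mul0r. Qed.

Lemma entryN a i j : entry (- a) i j = - entry a i j.
Proof. by rewrite -scaleN1r entryZ mulN1r. Qed.

Lemma entryB a b i j : entry (a - b) i j = entry a i j - entry b i j.
Proof. by rewrite entryD entryN. Qed.

Lemma entry_sum (I : Type) (r : seq I) (P : pred I) (f : I -> I1 K) i j :
  entry (\sum_(k <- r | P k) f k) i j = \sum_(k <- r | P k) entry (f k) i j.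
Proof.
apply: (big_morph (fun a => entry a i j)) => [a b|]; first exact: entryD.
exact: entry0.
Qed.

Lemma entry_finite_col a j : exists L, forall i, (L <= i)%N -> entry a i j = 0.
Proof.
exists (size (papp (val a) (dpow j))) => i leLi.
by rewrite /entry nth_default // mul0r.
Qed.

Context (char0 : [pchar K] =i pred0).

Lemma natf_eq0 n : (n%:R == 0 :> K) = (n == 0%N).
Proof. exact: (pcharf0P K).1. Qed.

Lemma natf_inj : injective (fun n => n%:R : K).
Proof.
move=> m n /eqP; wlog le_mn : m n / (m <= n)%N => [ihyp|].
  by case: (leqP m n) => [/ihyp|/ltnW/ihyp I]; last by rewrite eq_sym => /I.
rewrite eq_sym -subr_eq0 -natrB // natf_eq0 subn_eq0 => le_nm.
by apply/eqP; rewrite eqn_leq le_mn.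
Qed.

Lemma factf_neq0 n : n`!%:R != 0 :> K.
Proof. by rewrite natf_eq0 -lt0n fact_gt0. Qed.

Lemma papp_dpow a j N : (forall i, (N <= i)%N -> entry a i j = 0) ->
  papp (val a) (dpow j) = \sum_(i < N) entry a i j *: dpow i.
Proof.
move=> aN; apply/polyP => k; rewrite coef_sum.
case: (ltnP k N) => [ltkN|leNk].
  rewrite (bigD1 (Ordinal ltkN)) //= big1 => [|i nik].
    rewrite addr0 /dpow scalerA coefZ coefXn eqxx mulr1 /entry.
    by rewrite mulfK // factf_neq0.
  rewrite /dpow !coefZ coefXn; case: eqP => [eki|]; last by rewrite !mulr0.
  by case/eqP: nik; apply: val_inj.
rewrite big1 => [|i _]; last first.
  by rewrite /dpow !coefZ coefXn gtn_eqF ?mulr0 // (leq_trans (ltn_ord i)).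
have /eqP := aN _ leNk; rewrite /entry mulf_eq0 (negPf (factf_neq0 k)) orbF.
by move/eqP.
Qed.

Lemma entry_ext a b : (forall i j, entry a i j = entry b i j) -> a = b.
Proof.
move=> ab; apply/val_inj/polyEnd_ext => n; apply/polyP => i.
have := ab i n; rewrite /entry /dpow /papp !linearZ /= !coefZ => /(mulIf (factf_neq0 i)).
by apply: mulfI; rewrite invr_eq0 factf_neq0.
Qed.

Lemma entryM a b i j L : (forall k, (L <= k)%N -> entry b k j = 0) ->
  entry (a * b) i j = \sum_(k < L) entry a i k * entry b k j.
Proof.
move=> bL; rewrite {1}/entry.
change (papp (val (a * b)) (dpow j)) with (papp (val a) (papp (val b) (dpow j))).
rewrite (papp_dpow bL) /papp linear_sum coef_sum mulr_suml.
by apply: eq_bigr => k _; rewrite linearZ coefZ -mulrA mulrC.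
Qed.

(** Serves the shifts, the diagonal matrices and the matrix units, for which at most
one term of the sum over the intermediate index is nonzero. *)
Lemma entryM1 k a b i j :
  (forall l, l != k -> entry a i l * entry b l j = 0) ->
  entry (a * b) i j = entry a i k * entry b k j.
Proof.
move=> ab0; have [L bL] := entry_finite_col b j.
rewrite (@entryM _ _ _ _ (maxn L k.+1)) => [|l]; last first.
  by rewrite geq_max => /andP[/bL].
have lt_kL : (k < maxn L k.+1)%N by rewrite leq_max leqnn orbT.
rewrite (bigD1 (Ordinal lt_kL)) //= big1 ?addr0 // => l nlk.
by apply: ab0; apply: contraNneq nlk => elk; exact/eqP/val_inj.
Qed.

Lemma entryM0 a b i j :
  (forall l, entry a i l * entry b l j = 0) -> entry (a * b) i j = 0.
Proof. by move=> ab0; rewrite (@entryM1 0) // => l _. Qed.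

Lemma entry1 i j : entry (1 : I1 K) i j = (i == j)%:R.
Proof.
rewrite /entry; change (papp (val 1) (dpow j)) with (dpow j); rewrite coefZ coefXn.
by case: eqVneq => [->|_]; rewrite ?mulr0 ?mul0r // mulr1 mulVf // factf_neq0.
Qed.

Lemma entry_der i j : entry (Ider K) i j = (j == i.+1)%:R.
Proof.
rewrite /entry act_d derivZ derivXn -scaler_nat scalerA coefZ coefXn.
case: j => [|j]; first by rewrite mulr0 !mul0r.
rewrite eqSS [j == i]eq_sym; case: eqVneq => [->|_]; last by rewrite mulr0 mul0r.
by rewrite mulr1 -mulrA -natrM -factS mulVf ?factf_neq0.
Qed.

Lemma entry_int i j : entry (Iint K) i j = (i == j.+1)%:R.
Proof.
rewrite entryE act_int_Xn coefZ coefXn.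
case: eqVneq => [->|_]; last by rewrite mulr0 mul0r.
by rewrite mulr1 mulrCA -invfM -natrM -factS mulfV ?factf_neq0.
Qed.

Lemma entry_hornerH p i j :
  entry (horner_alg (IH K) p) i j = if i == j then p.[j.+1%:R] else 0.
Proof.
rewrite entryE act_horner_H // coefZ coefXn.
case: eqVneq => [->|_]; last by rewrite mulr0 mul0r.
by rewrite mulr1 mulfV ?factf_neq0 // mulr1.
Qed.

Lemma entry_e k l i j : entry (e K k l) i j = ((i == k) && (j == l))%:R.
Proof.
rewrite /entry act_e //; case: (eqVneq j l) => [_|_]; last by rewrite coef0 mul0r andbF.
rewrite coefZ coefXn andbT; case: eqVneq => [->|_]; last by rewrite mulr0 mul0r.
by rewrite mulr1 mulVf // factf_neq0.
Qed.

Lemma entry_derM a i j : entry (Ider K * a) i j = entry a i.+1 j.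
Proof.
rewrite (@entryM1 i.+1) => [|l nl]; rewrite entry_der ?eqxx ?mul1r //.
by rewrite (negPf nl) mul0r.
Qed.

Lemma entry_intM a i j :
  entry (Iint K * a) i j = if i is k.+1 then entry a k j else 0.
Proof.
case: i => [|i]; first by apply: entryM0 => l; rewrite entry_int mul0r.
rewrite (@entryM1 i) => [|l nl]; rewrite entry_int eqSS ?eqxx ?mul1r //.
by rewrite eq_sym (negPf nl) mul0r.
Qed.

Lemma entry_derXM k a i j : entry (Ider K ^+ k * a) i j = entry a (i + k) j.
Proof.
elim: k i => [|k ihyp] i; first by rewrite mul1r addn0.
by rewrite exprS -mulrA entry_derM ihyp addSnnS.
Qed.

Lemma entry_intXM k a i j :
  entry (Iint K ^+ k * a) i j = if (k <= i)%N then entry a (i - k) j else 0.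
Proof.
elim: k i => [|k ihyp] i; first by rewrite mul1r subn0.
by rewrite exprS -mulrA entry_intM; case: i.
Qed.

Lemma entry_derX k i j : entry (Ider K ^+ k) i j = (j == i + k)%N%:R.
Proof. by rewrite -[_ ^+ k]mulr1 entry_derXM entry1 eq_sym. Qed.

Lemma entry_intX k i j : entry (Iint K ^+ k) i j = (i == j + k)%N%:R.
Proof.
rewrite -[_ ^+ k]mulr1 entry_intXM entry1.
case: leqP => h; first by congr (nat_of_bool _)%:R; lia.
by have -> : (i == (j + k)%N) = false by lia.
Qed.

Lemma entry_MderX k a i j :
  entry (a * Ider K ^+ k) i j = if (k <= j)%N then entry a i (j - k) else 0.
Proof.
case: leqP => lekj; last first.
  by apply: entryM0 => l; rewrite entry_derX; case: eqP => [|_]; [lia|rewrite mulr0].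
rewrite (@entryM1 (j - k)%N) => [|l nl]; rewrite entry_derX.
  by rewrite subnK // eqxx mulr1.
by case: eqP => [|_]; [lia|rewrite mulr0].
Qed.

Lemma entry_HM p a i j :
  entry (horner_alg (IH K) p * a) i j = p.[i.+1%:R] * entry a i j.
Proof.
rewrite (@entryM1 i) => [|l nl]; rewrite entry_hornerH ?eqxx //.
by rewrite eq_sym (negPf nl) mul0r.
Qed.

Lemma entry_MH p a i j :
  entry (a * horner_alg (IH K) p) i j = entry a i j * p.[j.+1%:R].
Proof.
rewrite (@entryM1 j) => [|l nl]; rewrite entry_hornerH ?eqxx //.
by rewrite (negPf nl) mulr0.
Qed.

Lemma mulHE a : IH K * a = horner_alg (IH K) 'X * a.
Proof. by rewrite horner_algX. Qed.

Lemma e_mul i j k l : e K i j * e K k l = (j == k)%:R *: e K i l.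
Proof.
apply: entry_ext => m n; rewrite entryZ (@entryM1 j) => [|h nh]; rewrite !entry_e.
  by rewrite eqxx andbT; case: eqVneq; case: eqVneq; rewrite ?mulr0 ?mul0r ?mul1r.
by rewrite (negPf nh) andbF mul0r.
Qed.

End Entries.

(** * Standard form, involution and shape of the elements of I_1 *)

Section StandardForm.
Context {K : fieldType}.
Implicit Types (a b : I1 K) (p q : {poly K}) (c : K).
Context (char0 : [pchar K] =i pred0).
Local Notation evH := (horner_alg (IH K)).

Definition monomials : set (I1 K) :=
  [set a | [\/ exists k p, a = Iint K ^+ k * evH p,
               exists k p, a = evH p * Ider K ^+ k |
               exists i j, a = e K i j]].

Lemma lspan_intX k p : lspan monomials (Iint K ^+ k * evH p).
Proof. by apply: sub_lspan; apply: Or31; exists k, p. Qed.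

Lemma lspan_derX k p : lspan monomials (evH p * Ider K ^+ k).
Proof. by apply: sub_lspan; apply: Or32; exists k, p. Qed.

Lemma lspan_e i j : lspan monomials (e K i j).
Proof. by apply: sub_lspan; apply: Or33; exists i, j. Qed.

Lemma entry_intX_evH k p i j :
  entry (Iint K ^+ k * evH p) i j = if (i == j + k)%N then p.[j.+1%:R] else 0.
Proof. by rewrite entry_MH // entry_intX //; case: ifP; rewrite ?mul1r ?mul0r. Qed.

Lemma entry_evH_derX k p i j :
  entry (evH p * Ider K ^+ k) i j = if (j == i + k)%N then p.[i.+1%:R] else 0.
Proof. by rewrite entry_HM // entry_derX //; case: ifP; rewrite ?mulr1 ?mulr0. Qed.

(** \partial p(H) = p(H+1) \partial. *)
Let der_left a : lspan monomials a -> lspan monomials (Ider K * a).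
Proof.
move: a; apply: lspan_ind => [|c u v|_ [[k [p ->]]|[k [p ->]]|[i [j ->]]]].
- by rewrite mulr0; exact: lspan0.
- by rewrite mulrDr -scalerAr; exact: lspanL.
- case: k => [|k].
    have -> : Ider K * (Iint K ^+ 0 * evH p) = evH (p \Po ('X + 1)) * Ider K ^+ 1.
      apply: (entry_ext char0) => i j.
      rewrite entry_derM // entry_intX_evH entry_evH_derX addn0 addn1 eq_sym.
      by case: eqP => // ->; rewrite horner_comp !hornerE natr1.
    exact: lspan_derX.
  have -> : Ider K * (Iint K ^+ k.+1 * evH p) = Iint K ^+ k * evH p.
    apply: (entry_ext char0) => i j.
    by rewrite entry_derM // !entry_intX_evH addnS eqSS.
  exact: lspan_intX.
- have -> : Ider K * (evH p * Ider K ^+ k) = evH (p \Po ('X + 1)) * Ider K ^+ k.+1.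
    apply: (entry_ext char0) => i j.
    rewrite entry_derM // !entry_evH_derX addnS addSn.
    by case: eqP => // _; rewrite horner_comp !hornerE natr1.
  exact: lspan_derX.
- case: i => [|i].
    have -> : Ider K * e K 0 j = 0; last exact: lspan0.
    by apply: (entry_ext char0) => i k; rewrite entry_derM // entry_e // entry0.
  have -> : Ider K * e K i.+1 j = e K i j; last exact: lspan_e.
  by apply: (entry_ext char0) => k l; rewrite entry_derM // !entry_e // eqSS.
Qed.

Let int_left a : lspan monomials a -> lspan monomials (Iint K * a).
Proof.
move: a; apply: lspan_ind => [|c u v|_ [[k [p ->]]|[k [p ->]]|[i [j ->]]]].
- by rewrite mulr0; exact: lspan0.
- by rewrite mulrDr -scalerAr; exact: lspanL.
- by rewrite mulrA -exprS; exact: lspan_intX.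
- case: k => [|k]; first by rewrite mulr1 -[Iint K]expr1; exact: lspan_intX.
  (* \int\partial = 1 - e_00, which is where the matrix units come from *)
  pose q := p \Po ('X - 1).
  have -> : Iint K * (evH p * Ider K ^+ k.+1) =
            (- q.[1]) *: e K 0 k + evH q * Ider K ^+ k.
    apply: (entry_ext char0) => i j.
    rewrite entry_intM // entryD entryZ entry_e // entry_evH_derX.
    case: i => [|i].
      by rewrite add0n; case: (eqVneq j k) => _; rewrite ?mulr1 ?addNr // mulr0 addr0.
    rewrite entry_evH_derX mulr0 add0r addnS addSn; case: eqP => // _.
    by rewrite horner_comp !hornerE -(natr1 i.+1) addrK.
  by apply: lspanL; [exact: lspan_e | exact: lspan_derX].
- have -> : Iint K * e K i j = e K i.+1 j; last exact: lspan_e.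
  by apply: (entry_ext char0) => -[|k] l; rewrite entry_intM // !entry_e.
Qed.

Let H_left a : lspan monomials a -> lspan monomials (IH K * a).
Proof.
rewrite mulHE; move: a; apply: lspan_ind => [|c u v|_ [[k [p ->]]|[k [p ->]]|[i [j ->]]]].
- by rewrite mulr0; exact: lspan0.
- by rewrite mulrDr -scalerAr; exact: lspanL.
- have -> : evH 'X * (Iint K ^+ k * evH p) = Iint K ^+ k * evH (('X + k%:R%:P) * p).
    apply: (entry_ext char0) => i j; rewrite entry_HM // !entry_intX_evH.
    case: eqP => [->|_]; last by rewrite mulr0.
    by rewrite !hornerE -natrD addSn.
  exact: lspan_intX.
- by rewrite mulrA -rmorphM; exact: lspan_derX.
- have -> : evH 'X * e K i j = i.+1%:R *: e K i j.
    apply: (entry_ext char0) => k l; rewrite entry_HM // entryZ !entry_e // hornerX.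
    by case: eqVneq => [->|]; rewrite // !mulr0.
  by apply: lspanZ; exact: lspan_e.
Qed.

(** The span of the monomials contains 1 and is stable under left multiplication
by \partial, \int and H, hence by x = \int H: it is a left ideal containing 1. *)
Lemma I1_standard_form a : lspan monomials a.
Proof.
have stable b : forall m, lspan monomials m -> lspan monomials (b * m).
  elim/I1_ind: b => [m|c b b' IHb IHb' m m_|b b' IHb IHb' m m_|m m_|m|m].
  - by rewrite mul1r.
  - by rewrite mulrDl -scalerAl; apply: lspanL; [exact: IHb | exact: IHb'].
  - by rewrite -mulrA; exact: IHb (IHb' _ m_).
  - by rewrite IxE // -mulrA; apply: int_left; exact: H_left.
  - exact: der_left.
  - exact: int_left.
rewrite -[a]mulr1; apply: stable.
have -> : (1 : I1 K) = Iint K ^+ 0 * evH 1 by rewrite rmorph1 mulr1.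
exact: lspan_intX.
Qed.

Let starI := star_is_involution char0.

Lemma starL c a b : star K (c *: a + b) = c *: star K a + star K b.
Proof. by have [sL _ _ _ _] := starI; rewrite sL. Qed.

Lemma star1 : star K 1 = 1.
Proof. by have [_ s1 _ _ _] := starI. Qed.

Lemma starM a b : star K (a * b) = star K b * star K a.
Proof. by have [_ _ sM _ _] := starI; rewrite sM. Qed.

Lemma starK : involutive (star K).
Proof. by have [_ _ _ sK _] := starI. Qed.

Lemma star_der : star K (Ider K) = Iint K.
Proof. by have [_ _ _ _ []] := starI. Qed.

Lemma star_int : star K (Iint K) = Ider K.
Proof. by have [_ _ _ _ []] := starI. Qed.

Lemma star_H : star K (IH K) = IH K.
Proof. by have [_ _ _ _ []] := starI. Qed.

Lemma star0 : star K 0 = 0.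
Proof. by have := starL (-1) 0 0; rewrite scaler0 addr0 scaleN1r addNr. Qed.

Lemma starD a b : star K (a + b) = star K a + star K b.
Proof. by have := starL 1 a b; rewrite !scale1r. Qed.

Lemma starZ c a : star K (c *: a) = c *: star K a.
Proof. by have := starL c a 0; rewrite star0 !addr0. Qed.

Lemma starX a n : star K (a ^+ n) = star K a ^+ n.
Proof. by elim: n => [|n ihyp]; rewrite ?star1 // exprS exprSr starM ihyp. Qed.

Lemma star_horner a p : star K (horner_alg a p) = horner_alg (star K a) p.
Proof.
elim/poly_ind: p => [|p c ihyp]; first by rewrite !rmorph0 star0.
rewrite rmorphD rmorphM /= horner_algX horner_algC starD starM starZ star1 ihyp.
by rewrite [in RHS]rmorphD [in RHS]mulrC rmorphM /= horner_algX horner_algC.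
Qed.

Lemma star_e i j : star K (e K i j) = e K j i.
Proof.
rewrite {1}/e starD -scaleN1r starZ !starM !starX star_int star_der.
by rewrite scaleN1r.
Qed.

(** By linearity this is only to be checked on the standard form, where * exchanges
\int^k p(H) with p(H) \partial^k and e_ij with e_ji. *)
Lemma entry_star a i j : entry (star K a) i j = entry a j i.
Proof.
move: a (I1_standard_form a); apply: lspan_ind => [|c u v IHu IHv|b].
- by rewrite star0 !entry0.
- by rewrite starL !entryD !entryZ IHu IHv.
case=> [[k [p ->]]|[k [p ->]]|[k [l ->]]].
- rewrite starM star_horner star_H starX star_int.
  by rewrite entry_evH_derX entry_intX_evH.
- rewrite starM star_horner star_H starX star_der.
  by rewrite entry_evH_derX entry_intX_evH.
- by rewrite star_e !entry_e // andbC.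
Qed.


Lemma entry_banded a : exists B, forall i j,
  (i > j + B)%N || (j > i + B)%N -> entry a i j = 0.
Proof.
move: a (I1_standard_form a); apply: lspan_ind => [|c u v [Bu uB] [Bv vB]|b].
- by exists 0%N => i j _; rewrite entry0.
- exists (maxn Bu Bv) => i j ij; rewrite entryD entryZ uB ?vB ?mulr0 ?addr0 //; lia.
case=> [[k [p ->]]|[k [p ->]]|[k [l ->]]].
- by exists k => i j ij; rewrite entry_intX_evH; case: eqP => //; lia.
- by exists k => i j ij; rewrite entry_evH_derX; case: eqP => //; lia.
- exists (k + l)%N => i j ij; rewrite entry_e //.
  by case: eqP => //; case: eqP => //; lia.
Qed.

(** Two offsets k and l treat the diagonals above and below the main one at once. *)
Lemma entry_eventually_poly a k l : exists (p : {poly K}) (N : nat),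
  forall n, (N <= n)%N -> entry a (n + k) (n + l) = p.[n%:R].
Proof.
move: a (I1_standard_form a); apply: lspan_ind => [|c u v [pu [Nu Eu]] [pv [Nv Ev]]|b].
- by exists 0, 0%N => n _; rewrite entry0 horner0.
- exists (c *: pu + pv), (maxn Nu Nv) => n; rewrite geq_max => /andP[/Eu Eun /Ev Evn].
  by rewrite entryD entryZ Eun Evn !hornerE.
case=> [[m [p ->]]|[m [p ->]]|[i [j ->]]].
- exists (if (k == l + m)%N then p \Po ('X + l.+1%:R%:P) else 0), 0%N => n _.
  rewrite entry_intX_evH -addnA eqn_add2l; case: eqP => _; last by rewrite horner0.
  by rewrite horner_comp !hornerE -natrD addnS.
- exists (if (l == k + m)%N then p \Po ('X + k.+1%:R%:P) else 0), 0%N => n _.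
  rewrite entry_evH_derX -addnA eqn_add2l; case: eqP => _; last by rewrite horner0.
  by rewrite horner_comp !hornerE -natrD addnS.
- exists 0, i.+1 => n lt_in; rewrite entry_e // horner0.
  by case: eqP => //; lia.
Qed.

End StandardForm.

(** * Centralizers of polynomials in H *)

(** Makes finitely many thresholds, one for each diagonal in the band, uniform. *)
Lemma uniform_bound (P : nat -> nat -> Prop) :
  (forall k, exists N, forall n, (N <= n)%N -> P k n) ->
  forall B, exists N, forall k n, (k <= B)%N -> (N <= n)%N -> P k n.
Proof.
move=> PN; elim=> [|B [N ihyp]].
  by have [N P0] := PN 0%N; exists N => k n; rewrite leqn0 => /eqP->; exact: P0.
have [M PM] := PN B.+1; exists (maxn N M) => k n.
rewrite geq_max leq_eqVlt => /predU1P[->|lekB] /andP[leN leM]; first exact: PM.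
exact: ihyp.
Qed.

Section Centralizers.
Context {K : fieldType}.
Implicit Types (a b : I1 K) (p q : {poly K}) (c : K).
Context (char0 : [pchar K] =i pred0).
Local Notation evH := (horner_alg (IH K)).

Lemma poly_eq0_nat p (f : nat -> nat) : injective f ->
  (forall n, p.[(f n)%:R] = 0) -> p = 0.
Proof.
move=> f_inj p0; apply/eqP/contraT => nz_p.
pose rs : seq K := [seq (f n)%:R | n <- iota 0 (size p)].
have := @max_poly_roots _ p rs nz_p; rewrite size_map size_iota ltnn; apply.
  by apply/allP => _ /mapP[n _ ->]; apply/eqP/p0.
by rewrite map_inj_uniq ?iota_uniq // => m n /(natf_inj char0)/f_inj.
Qed.

Lemma poly_eq0_large p N : (forall n, (N <= n)%N -> p.[n%:R] = 0) -> p = 0.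
Proof.
move=> p0; apply: (@poly_eq0_nat _ (addn N)) => [|n]; first exact: addnI.
by apply: p0; exact: leq_addr.
Qed.

(** With the relations =, > and < for Q, the three components of the direct sum, up
to a polynomial in H in the first one. *)
Definition block (Q : rel nat) N a : I1 K :=
  \sum_(i < N) \sum_(j < N | Q i j) entry a i j *: e K i j.

Lemma entry_block Q N a i j : entry (block Q N a) i j =
  if [&& Q i j, (i < N)%N & (j < N)%N] then entry a i j else 0.
Proof.
rewrite /block entry_sum.
under eq_bigr do rewrite entry_sum.
case: (boolP [&& _, _ & _]) => [/and3P[Qij ltiN ltjN]|nQ].
  rewrite (bigD1 (Ordinal ltiN)) //= [X in _ + X]big1 => [|k nki]; last first.
    rewrite big1 // => l _; rewrite entryZ entry_e //.
    case: eqP => [eik|_]; last by rewrite mulr0.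
    by case/eqP: nki; apply: val_inj.
  rewrite addr0 (bigD1 (Ordinal ltjN)) //= big1 => [|l /andP[_ nlj]].
    by rewrite addr0 entryZ entry_e // !eqxx mulr1.
  rewrite entryZ entry_e //; case: (eqVneq j l) => [ejl|_]; last by rewrite andbF mulr0.
  by case/eqP: nlj; apply: val_inj.
rewrite big1 // => k _; rewrite big1 // => l Qkl; rewrite entryZ entry_e //.
case: eqP => [eik|_]; last by rewrite mulr0.
case: eqP => [ejl|_]; last by rewrite mulr0.
by rewrite eik ejl Qkl !ltn_ord in nQ.
Qed.

Lemma lspan_block (G : set (I1 K)) (Q : rel nat) N a :
  (forall i j, Q i j -> entry a i j != 0 -> lspan G (e K i j)) ->
  lspan G (block Q N a).
Proof.
move=> GQ; apply: lspan_sum => i _; apply: lspan_sum => j Qij.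
case: (eqVneq (entry a i j) 0) => [->|nz]; first by rewrite scale0r; exact: lspan0.
by apply: lspanZ; exact: GQ.
Qed.

Lemma F_entryP a : F K a <->
  exists N, forall i j, (N <= i)%N || (N <= j)%N -> entry a i j = 0.
Proof.
split.
  move: a; apply: lspan_ind => [|c u v [Nu uN] [Nv vN]|_ [[k l] _ <-]].
  - by exists 0%N => i j _; rewrite entry0.
  - exists (maxn Nu Nv) => i j ij; rewrite entryD entryZ uN ?vN ?mulr0 ?addr0 //; lia.
  - exists (maxn k l).+1 => i j ij; rewrite entry_e //=.
    by case: eqP => //; case: eqP => //; lia.
case=> N aN; have -> : a = block (fun _ _ => true) N a.
  apply: (entry_ext char0) => i j; rewrite entry_block /=.
  by case: ifP => // h; apply: aN; lia.
by apply: lspan_block => i j _ _; apply: sub_lspan; exists (i, j).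
Qed.

Lemma KH_F_entryP a : addsets (polys_in (IH K)) (F K) a <->
  exists p N, forall i j, (N <= i)%N || (N <= j)%N ->
    entry a i j = if i == j then p.[j.+1%:R] else 0.
Proof.
split=> [[_ [p _ <-] [f /F_entryP[N fN] <-]]|[p [N aN]]].
  by exists p, N => i j ij; rewrite entryD fN // addr0 entry_hornerH.
exists (evH p); first by exists p.
exists (a - evH p); last by rewrite addrC subrK.
by apply/F_entryP; exists N => i j ij; rewrite entryB aN // entry_hornerH // subrr.
Qed.

(** The eventual polynomial of the main diagonal gives the component in K[H]. Only
finitely many other diagonals are nonzero, so they leave finitely many entries. *)
Lemma KH_F_offdiag a :
  (forall k l, k != l -> exists N, forall n, (N <= n)%N -> entry a (n + k) (n + l) = 0) ->
  addsets (polys_in (IH K)) (F K) a.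
Proof.
move=> a0; have [B aB] := entry_banded char0 a.
have [p [N0 aN0]] := entry_eventually_poly char0 a 0 0.
have [N1 aN1] : exists N, forall k n, (k <= B)%N -> (N <= n)%N ->
    k != 0%N -> entry a (n + k) n = 0.
  apply: uniform_bound => k; case: (eqVneq k 0%N) => [_|nk]; first by exists 0%N.
  by have [N aN] := a0 k 0%N nk; exists N => n /aN; rewrite addn0.
have [N2 aN2] : exists N, forall k n, (k <= B)%N -> (N <= n)%N ->
    k != 0%N -> entry a n (n + k) = 0.
  apply: uniform_bound => k; case: (eqVneq k 0%N) => [_|nk]; first by exists 0%N.
  have [|N aN] := a0 0%N k; first by rewrite eq_sym.
  by exists N => n /aN; rewrite addn0.
(* q(H) has diagonal entries q(n + 1), whence the shift *)
apply/KH_F_entryP; exists (p \Po ('X - 1)), (maxn N0 (maxn N1 N2) + B)%N => i j ij.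
case: (ltngtP i j) => [ltij|ltji|eij].
- case: (leqP (j - i) B) => [le|gt]; last by apply: aB; lia.
  by have := aN2 (j - i)%N i; rewrite subnKC ?(ltnW ltij) //; apply; lia.
- case: (leqP (i - j) B) => [le|gt]; last by apply: aB; lia.
  by have := aN1 (i - j)%N j; rewrite subnKC ?(ltnW ltji) //; apply; lia.
- rewrite -eij; have := aN0 i; rewrite !addn0 => ->; last by lia.
  by rewrite horner_comp !hornerE -natr1 addrK.
Qed.

Lemma cen_evH_entryP p b : centralizer (evH p) b <->
  forall i j, p.[i.+1%:R] * entry b i j = entry b i j * p.[j.+1%:R].
Proof.
split=> [bp i j|bp].
  by rewrite -entry_HM // bp entry_MH.
by apply: (entry_ext char0) => i j; rewrite entry_HM // entry_MH.
Qed.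

Lemma cen_evH_offdiag p b i j : centralizer (evH p) b ->
  p.[i.+1%:R] != p.[j.+1%:R] -> entry b i j = 0.
Proof.
move=> /cen_evH_entryP/(_ i j)/eqP.
rewrite [X in _ == X]mulrC -subr_eq0 -mulrBl mulf_eq0 subr_eq0.
by case/orP=> [->//|/eqP].
Qed.

(** If the two shifts of p agree, p takes the same value along an arithmetic
progression, which in characteristic zero makes it constant. *)
Lemma nonscalar_shift p k l : ~ scalars K (evH p) -> k != l ->
  p \Po ('X + k%:R%:P) != p \Po ('X + l%:R%:P).
Proof.
wlog lt_kl : k l / (k < l)%N => [ihyp pS nkl|].
  have /orP[h|h] : (k < l)%N || (l < k)%N by rewrite -neq_ltn.
  - exact: ihyp.
  - by rewrite eq_sym; apply: ihyp; rewrite // eq_sym.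
move=> pS _; apply/eqP => Ep; apply: pS.
have step n : p.[(k + n)%N%:R] = p.[(k + n + (l - k))%N%:R].
  have := congr1 (fun r => r.[n%:R]) Ep; rewrite !horner_comp !hornerE -!natrD.
  by rewrite addnC => ->; congr (_.[_%:R]); lia.
have per m : p.[(k + m * (l - k))%N%:R] = p.[k%:R].
  by elim: m => [|m <-]; rewrite ?addn0 // [in RHS]step -addnA mulSnr.
exists p.[k%:R] => //; rewrite -[in RHS](subrK (p.[k%:R])%:P p).
have -> : p - (p.[k%:R])%:P = 0.
  apply: (@poly_eq0_nat _ (fun m => k + m * (l - k))%N) => [m n /addnI|m].
    by move/eqP; rewrite eqn_pmul2r ?subn_gt0 // => /eqP.
  by rewrite !hornerE per subrr.
by rewrite add0r horner_algC.
Qed.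

(** A diagonal of b off the main one is eventually given by a polynomial q, and
q times a nonzero polynomial vanishes at all large integers. *)
Lemma cen_evH_sub_KH_F p b : ~ scalars K (evH p) -> centralizer (evH p) b ->
  addsets (polys_in (IH K)) (F K) b.
Proof.
move=> pS bp; apply: KH_F_offdiag => k l nkl.
have [q [N bN]] := entry_eventually_poly char0 b k l.
suff q0 : q = 0 by exists N => n /bN; rewrite q0 horner0.
have : q * ((p \Po ('X + k.+1%:R%:P)) - (p \Po ('X + l.+1%:R%:P))) = 0.
  apply: (@poly_eq0_large _ N) => n /bN qn; have := cen_evH_entryP p b.
  case=> /(_ bp (n + k)%N (n + l)%N) E _; rewrite !hornerM hornerD hornerN.
  rewrite !horner_comp !hornerE -!natrD !addnS mulrBr -qn -E.
  by rewrite mulrC subrr.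
move/eqP; rewrite mulf_eq0 subr_eq0 => /orP[/eqP//|E].
by have := @nonscalar_shift p k.+1 l.+1 pS nkl; rewrite E.
Qed.

Lemma D1_offdiag a i j : D1 K a -> i != j -> entry a i j = 0.
Proof.
move=> [_ [p _ <-] [f df <-]] nij; rewrite entryD entry_hornerH // (negPf nij) add0r.
move: f df; apply: lspan_ind => [|c u v u0 v0|_ [k _ <-]].
- by rewrite entry0.
- by rewrite entryD entryZ u0 v0 mulr0 addr0.
- rewrite entry_e //; case: eqP => //= ik; case: eqP => //= jk.
  by rewrite ik jk eqxx in nij.
Qed.

Lemma D1_block p N b : D1 K (evH p + block eq_op N b).
Proof.
exists (evH p); first by exists p.
exists (block eq_op N b) => //; apply: lspan_block => i j /eqP <- _.
by apply: sub_lspan; exists i.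
Qed.

Lemma D1_entryP a : D1 K a <-> addsets (polys_in (IH K)) (F K) a /\
  forall i j, i != j -> entry a i j = 0.
Proof.
split=> [Da|[/KH_F_entryP[p [N aN]] ad]].
  split; last by move=> i j; exact: D1_offdiag.
  case: Da => x px [f df fE]; exists x => //; exists f => //.
  by apply: lspan_mono df => _ [i _ <-]; exists (i, i).
suff -> : a = evH p + block eq_op N (a - evH p) by exact: D1_block.
apply: (entry_ext char0) => i j; rewrite entryD entry_block entryB !entry_hornerH //.
case: (eqVneq i j) => [<-|nij]; last by rewrite addr0 ad.
rewrite /= andbb; case: ltnP => h; first by rewrite addrC subrK.
by rewrite addr0 aN ?h // eqxx.
Qed.

Lemma iter_tauE i p x : (iter i (@tau K) p).[x] = p.[x + i%:R].
Proof.
elim: i x => [|i ihyp] x /=; first by rewrite addr0.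
by rewrite horner_comp !hornerE ihyp -addrA [1 + _]addrC natr1.
Qed.

Lemma C_root p i j : root (iter i (@tau K) p - p) j.+1%:R =
  (p.[(i + j)%N.+1%:R] == p.[j.+1%:R]).
Proof.
by rewrite /root hornerD hornerN iter_tauE subr_eq0 -natrD addSn addnC.
Qed.

Lemma C_entry p a : C_ p a -> centralizer (evH p) a /\
  forall i j, (i <= j)%N -> entry a i j = 0.
Proof.
move: a; apply: lspan_ind => [|c u v [uc u0] [vc v0]|_ [[i j] [/= i1 rt] <-]].
- by split=> [|i j _]; rewrite ?entry0 // /centralizer /= mulr0 mul0r.
- split=> [|i j ij]; last by rewrite entryD entryZ u0 // v0 // mulr0 addr0.
  by move: uc vc; rewrite /centralizer /= mulrDr mulrDl -scalerAr -scalerAl => -> ->.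
- move: rt; rewrite C_root => /eqP Ep; split=> [|k l kl].
    apply/cen_evH_entryP => k l; rewrite entry_e //.
    case: eqP => [->|_]; last by rewrite mulr0 mul0r.
    case: eqP => [->|_]; last by rewrite mulr0 mul0r.
    by rewrite mulr1 mul1r Ep.
  by rewrite entry_e //; case: eqP => //; case: eqP => //; lia.
Qed.

Lemma star_cen p b : centralizer (evH p) b -> centralizer (evH p) (star K b).
Proof.
move=> /(congr1 (star K)); rewrite !(starM char0) (star_horner char0) (star_H char0).
exact: esym.
Qed.

Lemma C_block p N b : centralizer (evH p) b ->
  C_ p (block (fun i j => (j < i)%N) N b).
Proof.
move=> bp; apply: lspan_block => i j ltji nz; apply: sub_lspan.
exists (i - j, j)%N => /=; last by rewrite subnK // ltnW.
split; first by rewrite subn_gt0.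
rewrite C_root subnK ?(ltnW ltji) //; apply: contraNT nz => np.
by apply/eqP/(cen_evH_offdiag bp).
Qed.

Lemma cen_evH_dsum p : ~ scalars K (evH p) ->
  is_dsum (tnth [tuple D1 K; C_ p; star K @` C_ p]) (centralizer (evH p)).
Proof.
move=> pS; apply: is_dsum3 => [b|a b _ Da Cb [c Cc <-] abc].
  split=> [bp|[a [b' [_ [/D1_offdiag Da /C_entry[Cb _] [c /C_entry[Cc _] <-] ->]]]]].
    have /KH_F_entryP[q [N bN]] := cen_evH_sub_KH_F pS bp.
    exists (evH q + block eq_op N (b - evH q)), (block (fun i j => (j < i)%N) N b).
    exists (block (fun i j => (i < j)%N) N b); split.
    - exact: D1_block.
    - exact: C_block.
    - exists (block (fun i j => (j < i)%N) N (star K b)).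
        by apply: C_block; exact: star_cen.
      apply: (entry_ext char0) => i j; rewrite entry_star // !entry_block entry_star //.
      by rewrite [(j < N)%N && _]andbC.
    - apply: (entry_ext char0) => i j.
      rewrite !entryD !entry_block entryB !entry_hornerH //.
      case: (ltnP i N) => ltiN; last by rewrite !andbF !addr0 bN // ltiN.
      case: (ltnP j N) => ltjN; last by rewrite !andbF !addr0 bN // ltjN orbT.
      by case: ltngtP => _ /=; rewrite ?subr0 ?addr0 ?add0r // addrC subrK.
  have Da' : centralizer (evH p) a.
    apply/cen_evH_entryP => i j; case: (eqVneq i j) => [->|nij]; first exact: mulrC.
    by rewrite Da // mulr0 mul0r.
  have /= Cc' := star_cen Cc.
  by move: Da' Cb Cc'; rewrite /centralizer /= !mulrDr !mulrDl => -> -> ->.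
have [_ b0] := C_entry Cb; have [_ c0] := C_entry Cc.
have E i j : entry a i j + entry b i j + entry c j i = 0.
  by rewrite -[entry c j i](entry_star char0) -!entryD abc entry0.
split; apply: (entry_ext char0) => i j; rewrite ?entry_star // entry0; have := E i j.
- case: (eqVneq i j) => [->|nij]; last by rewrite D1_offdiag.
  by rewrite b0 // c0 // !addr0.
- case: (leqP i j) => [ij|ji]; first by rewrite b0.
  by rewrite D1_offdiag ?gtn_eqF // c0 ?(ltnW ji) // add0r addr0.
- case: (leqP j i) => [ij|ji]; first by rewrite c0.
  by rewrite D1_offdiag ?ltn_eqF // b0 ?(ltnW ji) // !add0r.
Qed.

Lemma cen_evH_D1 p : ~ scalars K (evH p) ->
  (forall i j, i != j -> p.[i.+1%:R] != p.[j.+1%:R]) ->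
  centralizer (evH p) = D1 K.
Proof.
move=> pS p_inj; apply/seteqP; split=> [b bp|b /D1_offdiag bd].
  apply/D1_entryP; split; first exact: cen_evH_sub_KH_F bp.
  by move=> i j /p_inj; exact: cen_evH_offdiag.
apply/cen_evH_entryP => i j; case: (eqVneq i j) => [->|nij]; first exact: mulrC.
by rewrite bd // mulr0 mul0r.
Qed.

End Centralizers.

(** * Failure of finiteness conditions *)

Section CentralizerProperties.
Context {K : fieldType}.
Implicit Types (a b : I1 K) (p q : {poly K}) (c : K) (B : set (I1 K)).
Context (char0 : [pchar K] =i pred0).

Lemma cenL a c u v : centralizer a u -> centralizer a v ->
  centralizer a (c *: u + v).
Proof.
by rewrite /centralizer /= mulrDr mulrDl -scalerAl -scalerAr => -> ->.
Qed.

Lemma cenM a u v : centralizer a u -> centralizer a v -> centralizer a (u * v).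
Proof. by rewrite /centralizer /= mulrA => -> ; rewrite -!mulrA => ->. Qed.

Lemma cenD a u v : centralizer a u -> centralizer a v -> centralizer a (u + v).
Proof. by move=> ua va; rewrite -[u]scale1r; exact: cenL. Qed.

Lemma cen0 a : centralizer a 0.
Proof. by rewrite /centralizer /= mulr0 mul0r. Qed.

(** Left multiplication does not enlarge the set of nonzero columns. *)
Lemma cen_not_left_noetherian a :
  (forall n, centralizer a (e K n n)) -> ~ left_noetherian (centralizer a).
Proof.
move=> ae; set B := centralizer a.
pose J n : set (I1 K) := [set b | B b /\ forall i j, (n <= j)%N -> entry b i j = 0].
move/(_ J) => [n|n b [Bb bn]|N JN].
- split=> [b []//||b c [Bb bn] [Bc cn]|r b Br [Bb bn]].
  + by split; [exact: cen0 | move=> i j _; rewrite entry0].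
  + by split; [exact: cenD | move=> i j ij; rewrite entryD bn // cn // addr0].
  + split; first exact: cenM.
    by move=> i j nj; apply: entryM0 => // l; rewrite bn // mulr0.
- by split=> // i j /ltnW; exact: bn.
have [_ /(_ N N (leqnn N))/eqP] : J N (e K N N).
  rewrite -(JN N.+1) //; split; [exact: ae | move=> i j lt_Nj].
  by rewrite entry_e // [j == N]gtn_eqF // andbF.
by rewrite entry_e // eqxx oner_eq0.
Qed.

(** Right multiplication does not enlarge the set of nonzero rows. *)
Lemma cen_not_right_noetherian a :
  (forall n, centralizer a (e K n n)) -> ~ right_noetherian (centralizer a).
Proof.
move=> ae; set B := centralizer a.
pose J n : set (I1 K) := [set b | B b /\ forall i j, (n <= i)%N -> entry b i j = 0].
move/(_ J) => [n|n b [Bb bn]|N JN].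
- split=> [b []//||b c [Bb bn] [Bc cn]|r b Br [Bb bn]].
  + by split; [exact: cen0 | move=> i j _; rewrite entry0].
  + by split; [exact: cenD | move=> i j ij; rewrite entryD bn // cn // addr0].
  + split; first exact: cenM.
    by move=> i j nj; apply: entryM0 => // l; rewrite bn // mul0r.
- by split=> // i j /ltnW; exact: bn.
have [_ /(_ N N (leqnn N))/eqP] : J N (e K N N).
  rewrite -(JN N.+1) //; split; [exact: ae | move=> i j lt_Nj].
  by rewrite entry_e // [i == N]gtn_eqF.
by rewrite entry_e // eqxx oner_eq0.
Qed.

(** A condition on columns only, so as to be stable under products. *)
Definition diag_beyond N : set (I1 K) := [set a | exists p : {poly K},
  forall i j, (N <= j)%N -> entry a i j = if i == j then p.[j.+1%:R] else 0].

Lemma diag_beyond_subalg N : GRing.subalg_closed (mem (diag_beyond N)).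
Proof.
split.
- apply/mem_set; exists 1 => i j _; rewrite entry1 // hornerC.
  by case: eqP.
- move=> c u v /set_mem[p up] /set_mem[q vq]; apply/mem_set; exists (c *: p + q).
  move=> i j Nj; rewrite entryD entryZ up // vq // !hornerE.
  by case: eqP; rewrite // mulr0 addr0.
- move=> u v /set_mem[p up] /set_mem[q vq]; apply/mem_set; exists (p * q).
  move=> i j Nj; rewrite (@entryM1 _ char0 j) => [|l nl]; last first.
    by rewrite vq // (negPf nl) mulr0.
  by rewrite up // vq // eqxx hornerM; case: eqP; rewrite // mul0r.
Qed.

(** Finitely many generators lie in a common subalgebra [diag_beyond N], which
misses e_NN: its eventual polynomial vanishes from N + 1 on, but not at N. *)
Lemma not_finitely_generated B : B `<=` addsets (polys_in (IH K)) (F K) ->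
  (forall n, B (e K n n)) -> ~ finitely_generated B.
Proof.
move=> BHF Be [s Bs].
have [N sN] : exists N, forall a, a \in s -> diag_beyond N a.
  have {Bs} : forall a, a \in s -> B a.
    by move=> a sa; rewrite Bs; exact: sub_gen_subalg.
  elim: s => [|a s ihyp] sB; first by exists 0%N.
  have [|N sN] := ihyp; first by move=> b sb; apply: sB; rewrite inE sb orbT.
  have [p [M aM]] := (KH_F_entryP char0 a).1 (BHF _ (sB _ (mem_head _ _))).
  exists (maxn N M) => b; rewrite inE => /predU1P[->|/sN[q bq]].
    by exists p => i j; rewrite geq_max => /andP[_ Mj]; rewrite aM // Mj orbT.
  by exists q => i j; rewrite geq_max => /andP[Nj _]; exact: bq.
have : gen_subalg [set` s] (e K N N) by rewrite -Bs.
move/(_ (diag_beyond N)) => [|p ep]; first by split=> //; exact: diag_beyond_subalg.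
have p0 : p = 0.
  apply: (@polyK_eq0 _ char0 _ N.+1) => n ltNn.
  by have := ep n n (ltnW ltNn); rewrite entry_e // gtn_eqF // eqxx.
have /eqP := ep N N (leqnn N).
by rewrite p0 entry_e // !eqxx horner0 oner_eq0.
Qed.

End CentralizerProperties.

(** * Centralizers inside the ideal F *)

Section FiniteDimensionalCentralizers.
Context {K : fieldType}.
Implicit Types (a b : I1 K) (p q : {poly K}) (c : K).
Context (char0 : [pchar K] =i pred0).

Lemma poly_eventually_neq0 q : q != 0 ->
  exists N, forall n, (N <= n)%N -> q.[n%:R] != 0.
Proof.
have [m] := ubnP (size q); elim: m q => // m ihyp q; rewrite ltnS => sq nzq.
have [[n0 q0]|noroot] := pselect (exists n : nat, q.[n%:R] = 0); last first.
  by exists 0%N => n _; apply/eqP => qn; apply: noroot; exists n.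
have /factor_theorem[r qr] : root q n0%:R by apply/eqP.
have nzr : r != 0 by apply: contraNneq nzq => r0; rewrite qr r0 mul0r.
have [|//|N rN] := ihyp r.
  by move: sq; rewrite qr size_Mmonic ?monicXsubC // size_XsubC addn2.
exists (maxn N n0.+1) => n; rewrite geq_max => /andP[leN ltn0].
rewrite qr hornerM mulf_neq0 ?rN // !hornerE subr_eq0.
by apply/eqP => /(natf_inj char0) en; rewrite en ltnn in ltn0.
Qed.

(** d is the distance of the lowest diagonal that is not eventually zero; it exists
because the matrix is banded. Taking N larger than the width B of the band disposes
of the finitely many columns in which the lower diagonals are not yet zero. *)
Lemma leading_diag a d0 : (0 < d0)%N ->
  ~ (exists N, forall n, (N <= n)%N -> entry a (n + d0) n = 0) ->
  exists d N, [/\ (0 < d)%N, forall n, (N <= n)%N -> entry a (n + d) n != 0 &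
    forall i j, (N + d <= i)%N -> (j + d < i)%N -> entry a i j = 0].
Proof.
move=> d0_gt0 ad0; have [B aB] := entry_banded char0 a.
pose P d := exists N, forall n, (N <= n)%N -> entry a (n + d) n = 0.
have PB d : ~ P d -> (d <= B)%N.
  move=> nP; case: leqP => // ltBd; case: nP; exists 0%N => n _.
  by apply: aB; rewrite ltn_add2l ltBd.
have exP : exists d, `[< ~ P d >] by exists d0; apply/asboolP.
have bP d : `[< ~ P d >] -> (d <= B)%N by move/asboolP/PB.
case: (ex_maxnP exP bP) => d /asboolP nPd maxd.
have [N0 aN0] : exists N, forall n, (N <= n)%N -> entry a (n + d) n != 0.
  have [q [N aN]] := entry_eventually_poly char0 a d 0.
  have [q0|/poly_eventually_neq0[M qM]] := eqVneq q 0.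
    by case: nPd; exists N => n /aN; rewrite q0 horner0 addn0.
  exists (maxn N M) => n; rewrite geq_max => /andP[/aN + /qM].
  by rewrite addn0 => ->.
have [N1 aN1] : exists N, forall k n, (k <= B)%N -> (N <= n)%N ->
    (d < k)%N -> entry a (n + k) n = 0.
  apply: uniform_bound => k; case: (ltnP d k) => [ltdk|_]; last by exists 0%N.
  have [[N aN]|nPk] := pselect (P k); first by exists N => n /aN.
  by have := maxd k; rewrite leqNgt ltdk => /(_ (asboolT nPk)).
exists d, (N0 + N1 + B)%N; split=> [|n leNn|i j lei ltji].
- by apply: leq_trans d0_gt0 _; apply: maxd; apply/asboolP.
- by apply: aN0; lia.
- case: (leqP (i - j) B) => [le|gt]; last by apply: aB; lia.
  by have := aN1 (i - j)%N j; rewrite subnKC; [apply; lia | lia].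
Qed.

Lemma Cen_F_L a c u v : Cen_F a u -> Cen_F a v -> Cen_F a (c *: u + v).
Proof.
by move=> [Fu au] [Fv av]; split; [exact: lspanL | exact: cenL].
Qed.

(** The leftmost nonzero entry of row i >= N + d of a is in column i - d. Comparing
the rows r + d of a f and f a, where r >= N is the last nonzero row of f, shows
that f has no such row. Comparing the columns j - d expresses column j of f, for
j >= N + d, by earlier ones. *)
Lemma Cen_F_finite_leading a d N : (0 < d)%N ->
  (forall n, (N <= n)%N -> entry a (n + d) n != 0) ->
  (forall i j, (N + d <= i)%N -> (j + d < i)%N -> entry a i j = 0) ->
  finite_dim (Cen_F a).
Proof.
move=> d_gt0 a_lead a0.
have rows f : Cen_F a f -> forall i j, (N <= i)%N -> entry f i j = 0.
  move=> [/(F_entryP char0)[M fM] af].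
  have step r : (N <= r)%N -> (forall i j, (r < i)%N -> entry f i j = 0) ->
      forall j, entry f r j = 0.
    move=> leNr f0 j; have := congr1 (fun b => entry b (r + d) j) af.
    rewrite (@entryM1 _ char0 r) => [|l nl].
      rewrite (@entryM0 _ char0 f) => [/eqP|l]; last first.
        by rewrite f0 ?mul0r // -[ltnLHS]addn0 ltn_add2l.
      by rewrite mulf_eq0 (negPf (a_lead _ leNr)) => /eqP.
    case: (ltngtP l r) nl => [ltlr|ltrl|->] // _.
      by rewrite a0 ?mul0r ?leq_add2r ?ltn_add2r.
    by rewrite f0 // mulr0.
  (* descending induction on the row, starting at M, where f vanishes *)
  have down k : forall i j, (N <= i)%N -> (M <= i + k)%N -> entry f i j = 0.
    elim: k => [|k ihyp] i j leNi.
      by rewrite addn0 => leMi; apply: fM; rewrite leMi.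
    move=> leM; apply: step => // i' j' lt; apply: ihyp; lia.
  by move=> i j leNi; apply: (down M) => //; rewrite leq_addl.
apply: (@finite_dim_functionals _ _ (N * (N + d)) _
  (fun n f => entry f (n %/ (N + d)) (n %% (N + d)))) => [n c u v|c u v|f af f0].
- by rewrite entryD entryZ.
- exact: Cen_F_L.
have cols j : forall i, entry f i j = 0.
  have [m] := ubnP j; elim: m j => // m ihyp j; rewrite ltnS => lejm i.
  case: (ltnP i N) => [ltiN|leNi]; last exact: rows.
  case: (ltnP j (N + d)) => [ltj|lej].
    have := f0 (i * (N + d) + j)%N; rewrite divnMDl ?modnMDl; last by lia.
    rewrite divn_small // modn_small // addn0; apply.
    have : (i.+1 * (N + d) <= N * (N + d))%N by rewrite leq_mul2r ltiN orbT.
    by rewrite mulSn; lia.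
  have [_ /(congr1 (fun b => entry b i (j - d)))] := af.
  rewrite (@entryM0 _ char0 a) => [|l]; last by rewrite ihyp ?mulr0 //; lia.
  rewrite (@entryM1 _ char0 j) => [/esym/eqP|l nl].
    rewrite mulf_eq0 => /orP[/eqP//|]; have := a_lead (j - d)%N.
    by rewrite subnK; [move/(_ _)/negPf-> => //; lia | lia].
  case: (ltngtP l j) nl => [ltlj|ltjl|->] // _.
    by rewrite ihyp ?mul0r //; lia.
  by rewrite a0 ?mulr0 //; lia.
by apply: (entry_ext char0) => i j; rewrite cols entry0.
Qed.

Lemma star_F a : F K a -> F K (star K a).
Proof.
move=> /(F_entryP char0)[N aN]; apply/(F_entryP char0); exists N => i j ij.
by rewrite entry_star // aN // orbC.
Qed.

Lemma star_cen_star a b : centralizer a b -> centralizer (star K a) (star K b).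
Proof. by move=> /(congr1 (star K)); rewrite !(starM char0) => /esym. Qed.

Lemma finite_dim_Cen_F_star a : finite_dim (Cen_F (star K a)) -> finite_dim (Cen_F a).
Proof.
move=> [s ss]; exists (map (star K) s) => f [Ff af].
have := ss (star K f) (conj (star_F Ff) (star_cen_star af)).
rewrite -{2}[f](starK char0); move: (star K f); apply: lspan_ind => [|c u v|u su].
- by rewrite star0 //; exact: lspan0.
- by rewrite starL //; exact: lspanL.
- by apply: sub_lspan; apply/mapP; exists u.
Qed.

(** When only diagonals above the main one are not eventually zero, the argument
applies to the transpose of a. *)
Lemma finite_dim_Cen_F a :
  finite_dim (Cen_F a) <-> ~ addsets (polys_in (IH K)) (F K) a.
Proof.
split=> [fin /(KH_F_entryP char0)[p [N aN]]|naHF].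
  apply: (@biorthogonal_infinite _ _ (Cen_F a)
    (fun n f => entry f (N + n) (N + n)) (fun n => e K (N + n) (N + n))) fin.
  - by move=> n c u v; rewrite entryD entryZ.
  - move=> n; split; first by apply: sub_lspan; exists (N + n, N + n)%N.
    rewrite /centralizer /=; apply: (entry_ext char0) => i j.
    rewrite (@entryM1 _ char0 (N + n)%N) => [|l nl]; last first.
      by rewrite entry_e // (negPf nl) mulr0.
    rewrite (@entryM1 _ char0 (N + n)%N) => [|l nl]; last first.
      by rewrite entry_e // (negPf nl) andbF mul0r.
    rewrite !entry_e // !aN ?leq_addr ?orbT // !eqxx /= andbT.
    rewrite [_ == j]eq_sym.
    case: (eqVneq i) => _; case: (eqVneq j) => [->|_];
      by rewrite ?mulr0 ?mul0r ?mulr1 ?mul1r.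
  - by move=> m n; rewrite entry_e // andbb eqn_add2l.
have [k [l [nkl nal]]] : exists k l, k != l /\
    ~ exists N, forall n, (N <= n)%N -> entry a (n + k) (n + l) = 0.
  apply: contrapT => none; apply: naHF; apply: (KH_F_offdiag char0) => k l nkl.
  by apply: contrapT => nal; apply: none; exists k, l.
have offset b k' l' : (l' < k')%N ->
    ~ (exists N, forall n, (N <= n)%N -> entry b (n + k') (n + l') = 0) ->
    finite_dim (Cen_F b).
  move=> ltlk nb; have [||d [N [d_gt0 b_lead b0]]] := @leading_diag b (k' - l').
  - by rewrite subn_gt0.
  - case=> N bN; apply: nb; exists N => n leNn.
    by have := bN (n + l')%N; rewrite -addnA subnKC ?(ltnW ltlk) //; apply; lia.
  exact: Cen_F_finite_leading b0.
have /orP[ltkl|ltlk] : (k < l)%N || (l < k)%N by rewrite -neq_ltn.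
- apply: finite_dim_Cen_F_star; apply: (offset _ l k) => // -[N aN]; apply: nal.
  by exists N => n /aN; rewrite entry_star.
- exact: offset nal.
Qed.

End FiniteDimensionalCentralizers.

(** * Centralizers of powers of the three generators *)

Section CentralizersOfPowers.
Context {K : fieldType}.
Implicit Types (a b : I1 K) (p q : {poly K}) (c : K).
Context (char0 : [pchar K] =i pred0).

(** On the multiples of the period, f g = q reads f(0) g = q; this holds at
infinitely many integers, hence identically. *)
Lemma periodic_eventually_rational (f : nat -> K) i g q N : (0 < i)%N ->
  (forall n, f (n + i)%N = f n) ->
  (forall n, (N <= n)%N -> f n * g.[n%:R] = q.[n%:R]) ->
  (forall n, (N <= n)%N -> g.[n%:R] != 0) ->
  forall n, f n = f 0%N.
Proof.
move=> i_gt0 f_per fq g_nz.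
have per n m : f (n + m * i)%N = f n.
  by elim: m => [|m ihyp]; rewrite ?addn0 // mulSnr addnA f_per ihyp.
have q0 : q - f 0%N *: g = 0.
  apply: (@poly_eq0_nat _ char0 _ (fun m => (N + m) * i)%N) => [m n /eqP|m].
    by rewrite eqn_pmul2r // eqn_add2l => /eqP.
  rewrite !hornerE -fq ?leq_pmulr //; last first.
    by rewrite (leq_trans (leq_addr m N)) // leq_pmulr.
  by rewrite -[X in f X]add0n per subrr.
move=> n; rewrite -(per n N); have le_N : (N <= n + N * i)%N.
  by rewrite (leq_trans _ (leq_addl _ _)) // leq_pmulr.
apply: (mulIf (g_nz _ le_N)); rewrite fq //.
by move/eqP: q0; rewrite subr_eq0 => /eqP ->; rewrite hornerZ.
Qed.

Lemma polys_in_sub_cen (a : I1 K) i : polys_in a `<=` centralizer (a ^+ i).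
Proof.
move=> _ [p _ <-]; rewrite /centralizer /=.
by rewrite -[a in a ^+ i](horner_algX a) -rmorphXn -!rmorphM mulrC.
Qed.

Lemma horner_algE (a : I1 K) p : horner_alg a p = \sum_(i < size p) p`_i *: a ^+ i.
Proof.
rewrite -{1}[p]coefK poly_def rmorph_sum; apply: eq_bigr => i _.
by rewrite -mul_polyC rmorphM rmorphXn /= horner_algX horner_algC -scalerAl mul1r.
Qed.

Lemma entry_horner_der p i j :
  entry (horner_alg (Ider K) p) i j = if (i <= j)%N then p`_(j - i) else 0.
Proof.
rewrite horner_algE entry_sum.
under eq_bigr do rewrite entryZ entry_derX //.
case: leqP => [leij|ltji]; last first.
  by rewrite big1 // => k _; case: eqP => [|_]; [lia | rewrite mulr0].
case: (ltnP (j - i) (size p)) => [lt|ge].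
  rewrite (bigD1 (Ordinal lt)) //= subnKC // eqxx mulr1 big1 ?addr0 // => k nk.
  case: eqP => [Ej|_]; last by rewrite mulr0.
  by case/eqP: nk; apply: val_inj; rewrite /= Ej addKn.
rewrite nth_default // big1 // => k _; have := ltn_ord k.
by case: eqP => [|_]; [lia | rewrite mulr0].
Qed.

(** b is constant along diagonals; a diagonal below the main one meets the corner
formed by the columns < i and the rows >= i, where b vanishes, so it is zero. *)
Lemma cen_der i : (0 < i)%N -> centralizer (Ider K ^+ i) = polys_in (Ider K).
Proof.
move=> i_gt0; apply/seteqP; split; last exact: polys_in_sub_cen.
move=> b /= Eb.
have bE k l : entry b (k + i) l = if (i <= l)%N then entry b k (l - i) else 0.
  by rewrite -entry_derXM // Eb entry_MderX.
have b_per k l : entry b (k + i) (l + i) = entry b k l.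
  by rewrite bE leq_addl addnK.
have b_const k l n : entry b (n + k) (n + l) = entry b k l.
  have [q [N bq]] := entry_eventually_poly char0 b k l.
  apply: (@periodic_eventually_rational (fun n => entry b (n + k) (n + l)) i 1 q N)
    => // [m|m /bq <-|m _].
  - by rewrite ![(m + i + _)%N]addnAC b_per.
  - by rewrite hornerC mulr1.
  - by rewrite hornerC oner_eq0.
have b_low k l : (l < k)%N -> entry b k l = 0.
  move=> ltlk; rewrite -(b_const k l i.-1).
  (* move to column i - 1 and a row >= i *)
  have -> : (i.-1 + k = (k.-1 - l + l) + i)%N by lia.
  have := b_const (k - l + i.-1)%N i.-1 l.
  have -> : (l + (k - l + i.-1) = k.-1 - l + l + i)%N by lia.
  rewrite [(l + _)%N]addnC => ->.
  have -> : (k - l + i.-1 = k - l.+1 + i)%N by lia.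
  by rewrite bE leqNgt prednK // leqnn.
have [B bB] := entry_banded char0 b.
exists (\poly_(d < B.+1) entry b 0 d) => //.
apply: (entry_ext char0) => k l; rewrite entry_horner_der.
case: leqP => [lekl|ltlk]; last by rewrite b_low.
have := b_const 0%N (l - k)%N k; rewrite addn0 subnKC // => ->; rewrite coef_poly.
by case: ltnP => // h; rewrite bB // add0n h orbT.
Qed.

Lemma cen_int i : (0 < i)%N -> centralizer (Iint K ^+ i) = polys_in (Iint K).
Proof.
move=> i_gt0; apply/seteqP; split; last exact: polys_in_sub_cen.
move=> b /(star_cen_star char0); rewrite starX // star_int // cen_der // => -[p _ Ep].
by exists p => //; rewrite -[b](starK char0) -Ep star_horner // star_der.
Qed.

Lemma papp_horner_x p (r : {poly K}) : papp (val (horner_alg (Ix K) p)) r = p * r.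
Proof.
elim/poly_ind: p r => [|p c ihyp] r; first by rewrite rmorph0 mul0r.
rewrite rmorphD rmorphM /= horner_algX horner_algC.
transitivity (papp (val (horner_alg (Ix K) p)) ('X * r) + c *: r); first by [].
by rewrite ihyp mulrDl mulrA mul_polyC.
Qed.

Lemma papp_xX i (r : {poly K}) : papp (val (Ix K ^+ i)) r = 'X^i * r.
Proof. by rewrite -[Ix K](horner_algX) -rmorphXn papp_horner_x. Qed.

(** Entries in the basis x^n, in which x is the shift without coefficients. *)
Definition xentry b i j : K := (papp (val b) 'X^j)`_i.

(** The value at n is (n+k)!/n!, the factor relating the bases x^n and x^n/n!. *)
Definition rise k : {poly K} := \prod_(s < k) ('X + s.+1%:R%:P).

Lemma riseE k n : (rise k).[n%:R] * n`!%:R = (n + k)`!%:R.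
Proof.
rewrite /rise; elim: k => [|k ihyp]; first by rewrite big_ord0 hornerC mul1r addn0.
rewrite big_ord_recr hornerM mulrAC ihyp !hornerE -natrD -natrM addnS factS.
by rewrite mulnC.
Qed.

Lemma rise_neq0 k n : (rise k).[n%:R] != 0.
Proof.
have : (n + k)`!%:R != 0 :> K by exact: factf_neq0.
by rewrite -riseE mulf_eq0 negb_or => /andP[].
Qed.

(** When one of the offsets is zero, the factor (n+l)!/(n+k)! by which the entries in
the two bases differ is a polynomial in n or the inverse of one. *)
Lemma xentry_rational b k l : k = 0%N \/ l = 0%N -> exists g q N,
  (forall n, (N <= n)%N -> xentry b (n + k) (n + l) * g.[n%:R] = q.[n%:R]) /\
  (forall n, g.[n%:R] != 0).
Proof.
have [q [N bq]] := entry_eventually_poly char0 b k l.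
case=> [k0|l0]; [exists 1, (q * rise l), N | exists (rise k), q, N]; split.
- move=> n /bq; rewrite entryE k0 addn0 -/(xentry _ _ _) -riseE => E.
  rewrite hornerM -E hornerC mulr1 invfM.
  by rewrite [n`!%:R * _]mulrCA mulfV ?factf_neq0 // mulr1 divfK ?rise_neq0.
- by move=> n; rewrite hornerC oner_eq0.
- move=> n /bq <-; rewrite entryE l0 addn0 -/(xentry _ _ _) -riseE.
  by rewrite mulfK ?factf_neq0.
- exact: rise_neq0.
Qed.

(** b is constant along diagonals in the basis x^n, and a diagonal above the main one
meets the corner formed by the rows < i and the columns >= i, where b vanishes. So
b x^n = b(1) x^n for all n. *)
Lemma cen_x i : (0 < i)%N -> centralizer (Ix K ^+ i) = polys_in (Ix K).
Proof.
move=> i_gt0; apply/seteqP; split; last exact: polys_in_sub_cen.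
move=> b /= Eb.
have bE k n : xentry b k (n + i) = if (k < i)%N then 0 else xentry b (k - i) n.
  have := congr1 (fun a => papp (val a) 'X^n) Eb.
  have -> : papp (val (Ix K ^+ i * b)) 'X^n = 'X^i * papp (val b) 'X^n.
    by rewrite -papp_xX.
  have -> : papp (val (b * Ix K ^+ i)) 'X^n = papp (val b) 'X^(n + i).
    by rewrite addnC exprD -papp_xX.
  by rewrite /xentry => <-; rewrite coefXnM.
have b_per k n : xentry b (k + i) (n + i) = xentry b k n.
  by rewrite bE ltnNge leq_addl addnK.
have b_const k l n : k = 0%N \/ l = 0%N -> xentry b (n + k) (n + l) = xentry b k l.
  move=> kl; have [g [q [N [bq g_nz]]]] := xentry_rational b kl.
  apply: (@periodic_eventually_rational (fun n => xentry b (n + k) (n + l)) i g q N)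
    => // m.
  by rewrite ![(m + i + _)%N]addnAC b_per.
have b_up l : (0 < l)%N -> xentry b 0 l = 0.
  move=> l_gt0; rewrite -(b_const 0%N l i.-1); last by left.
  have -> : (i.-1 + l = l.-1 + i)%N by lia.
  by rewrite bE addn0 prednK // leqnn.
exists (papp (val b) 1) => //; apply/val_inj/polyEnd_ext => n; apply/polyP => k.
rewrite papp_horner_x coefMXn -!/(xentry _ _ _).
case: ltnP => [ltkn|lenk].
  have := b_const 0%N (n - k)%N k; rewrite addn0 subnKC ?(ltnW ltkn) // => ->.
    by rewrite b_up // subn_gt0.
  by left.
have := b_const (k - n)%N 0%N n; rewrite addn0 subnKC // => ->; last by right.
by rewrite /xentry expr0.
Qed.

End CentralizersOfPowers.

(** * Examples, and the theorem *)

Section Examples.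
Context {K : fieldType}.
Context (char0 : [pchar K] =i pred0).
Implicit Types (a b : I1 K) (p : {poly K}).
Local Notation evH := (horner_alg (IH K)).

Lemma nonscalar_size p : (1 < size p)%N -> ~ scalars K (evH p).
Proof.
move=> sp [c _ cp]; suff pc : p = c%:P by move: sp; rewrite pc ltnNge size_polyC_leq1.
by apply: (horner_IH_inj char0); rewrite horner_algC -cp.
Qed.

Lemma e_diag_cen p n : centralizer (evH p) (e K n n).
Proof.
apply/(cen_evH_entryP char0) => i j; rewrite entry_e //.
by case: eqP => [->|_]; case: eqP => [->|_]; rewrite ?mulr0 ?mul0r // mulrC.
Qed.

Lemma cen_evH_not_finitely_generated p : ~ scalars K (evH p) ->
  ~ finitely_generated (centralizer (evH p)).
Proof.
move=> pS; apply: (not_finitely_generated char0) => [b|n]; first exact: cen_evH_sub_KH_F.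
exact: e_diag_cen.
Qed.

Lemma e_neq0 i j : e K i j <> 0.
Proof.
move=> /(congr1 (fun a => entry a i j)) /eqP.
by rewrite entry_e // !eqxx entry0 oner_eq0.
Qed.

Lemma cen_evH_not_domain p : ~ domain_alg (centralizer (evH p)).
Proof.
move=> /(_ _ _ (e_diag_cen p 0) (e_diag_cen p 1)).
by rewrite e_mul // scale0r => /(_ erefl) [] /e_neq0.
Qed.

Definition Hhalf : {poly K} := 'X - (3%:R / 2%:R)%:P.

Lemma two_neq0 : 2%:R != 0 :> K.
Proof. by rewrite natf_eq0. Qed.

(** The numbers i - 1/2 and j - 1/2 have the same square when equal or opposite. *)
Lemma Hhalf_sq_eq i j : ((Hhalf ^+ 2).[i.+1%:R] == (Hhalf ^+ 2).[j.+1%:R]) =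
  (i == j) || (i + j == 1)%N.
Proof.
rewrite !horner_exp !hornerXsubC eqf_sqr; congr (_ || _).
  rewrite (inj_eq (addIr _)); apply/eqP/eqP => [/(natf_inj char0)[]//|->//].
rewrite opprB -subr_eq0 opprB addrACA -natrD -opprD -mulrDl -natrD.
have -> : (3 + 3)%:R / 2%:R = 3%:R :> K.
  by rewrite -[(3 + 3)%N]/(3 * 2)%N natrM mulfK // two_neq0.
rewrite subr_eq0; apply/eqP/eqP => [/(natf_inj char0)|E]; first by lia.
by congr _%:R; lia.
Qed.

Lemma C_Hhalf_sq : C_ (Hhalf ^+ 2) = lspan [set e K 1 0].
Proof.
rewrite /C_; congr lspan; apply/seteqP; split=> [_ [[i j] [/= i1 ij] <-]|_ ->].
  move: ij; rewrite C_root Hhalf_sq_eq => ij.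
  have [-> ->] : i = 1%N /\ j = 0%N by lia.
  by [].
exists (1, 0)%N => //; split=> //.
by apply: (etrans (C_root _ 1 0)); rewrite Hhalf_sq_eq.
Qed.

Lemma star_lspan_e i j : star K @` lspan [set e K i j] = lspan [set e K j i].
Proof.
have sub k l : star K @` lspan [set e K k l] `<=` lspan [set e K l k].
  move=> _ [a + <-]; move: a; apply: lspan_ind => [|c u v|_ ->].
  - by rewrite star0 //; exact: lspan0.
  - by rewrite starL //; exact: lspanL.
  - by rewrite star_e //; exact: sub_lspan.
apply/seteqP; split; first exact: sub.
by move=> a ea; exists (star K a); [apply: sub; exists a | rewrite starK].
Qed.

End Examples.

Theorem proposition5p1 (K : fieldType) (char0 : [pchar K] =i pred0) :
  let H : I1 K := IH K in
  let h : I1 K := H - (3%:R / 2%:R)%:A in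
  (* (1) *)
  [/\ (forall p : {poly K}, let alpha := horner_alg H p in
         ~ scalars K alpha ->
         is_dsum (tnth [tuple D1 K; C_ p; star K @` C_ p]) (centralizer alpha) /\
         star K @` centralizer alpha = centralizer alpha),
      [/\ is_dsum (tnth [tuple D1 K; lspan [set e K 1 0]; lspan [set e K 0 1]])
            (centralizer (h ^+ 2)),
          ~ commutative_alg (centralizer (h ^+ 2)),
          ~ left_noetherian (centralizer (h ^+ 2)) /\
            ~ right_noetherian (centralizer (h ^+ 2)),
          ~ finitely_generated (centralizer (h ^+ 2)) &
          ~ domain_alg (centralizer (h ^+ 2))],
      (forall k : nat, (1 <= k)%N -> centralizer (H ^+ k) = D1 K) /\
        [/\ commutative_alg (D1 K),
            ~ left_noetherian (D1 K) /\ ~ right_noetherian (D1 K),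
            ~ finitely_generated (D1 K) & ~ domain_alg (D1 K)],
      centralizer h = D1 K /\ D1 K <> centralizer (h ^+ 2) &
  [/\ (* (2) *)
      (forall a : I1 K,
         finite_dim (Cen_F a) <-> ~ addsets (polys_in H) (F K) a),
      (* (3) *)
      (forall i : nat, (1 <= i)%N ->
         centralizer (Ider K ^+ i) = polys_in (Ider K)),
      (forall i : nat, (1 <= i)%N ->
         centralizer (Iint K ^+ i) = polys_in (Iint K)) &
      (* (4) *)
      (forall i : nat, (1 <= i)%N ->
         centralizer (Ix K ^+ i) = polys_in (Ix K))]].
Proof.
move=> H h.
have hE : h = horner_alg H Hhalf by rewrite rmorphB /= horner_algX horner_algC.
have h2E : h ^+ 2 = horner_alg H (Hhalf ^+ 2) by rewrite rmorphXn hE.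
have h2S : ~ scalars K (horner_alg H (Hhalf ^+ 2)).
  apply: (nonscalar_size char0).
  by rewrite expr2 size_Mmonic ?monicXsubC ?size_XsubC // -size_poly_eq0 size_XsubC.
have HX k : (1 <= k)%N -> centralizer (H ^+ k) = D1 K.
  move=> k_gt0; rewrite -[H](horner_algX H) -rmorphXn; apply: (cen_evH_D1 char0).
    by apply: (nonscalar_size char0); rewrite size_polyXn.
  move=> i j nij; rewrite !hornerXn -!natrX.
  by apply: contraNneq nij => /(natf_inj char0)/eqP; rewrite eqn_exp2r.
have D1E : D1 K = centralizer (horner_alg H 'X) by rewrite horner_algX -(HX 1%N).
have HS : ~ scalars K (horner_alg H 'X).
  by apply: (nonscalar_size char0); rewrite size_polyX.
have e10 : centralizer (h ^+ 2) (e K 1 0).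
  rewrite h2E; have := (C_entry char0 (p := Hhalf ^+ 2) (a := e K 1 0)).
  by rewrite (C_Hhalf_sq char0) => -[]//; exact: sub_lspan.
have e01 : centralizer (h ^+ 2) (e K 0 1).
  by rewrite -(star_e char0) h2E; apply: (star_cen char0); rewrite -h2E.
split.
- move=> p alpha pS; split; first exact: cen_evH_dsum.
  apply/seteqP; split=> [_ [b bp <-]|b bp]; first exact: star_cen.
  by exists (star K b); [exact: star_cen | exact: starK].
- split.
  + rewrite h2E -(star_lspan_e char0 1 0) -(C_Hhalf_sq char0); exact: cen_evH_dsum.
  + move=> /(_ _ _ e10 e01); rewrite !e_mul // !scale1r.
    move=> /(congr1 (fun a => entry a 0 0)) /eqP.
    by rewrite !entry_e // eq_sym oner_eq0.
  + rewrite h2E; split; [apply: (cen_not_left_noetherian char0) |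
      apply: (cen_not_right_noetherian char0)] => n; exact: e_diag_cen.
  + by rewrite h2E; exact: cen_evH_not_finitely_generated.
  + by rewrite h2E; exact: cen_evH_not_domain.
- split=> //; rewrite D1E; split.
  + rewrite -D1E => a b Da Db; apply: (entry_ext char0) => i j.
    rewrite (@entryM1 _ char0 i) => [|l nl]; last first.
      by rewrite (D1_offdiag char0 Da) ?mul0r // eq_sym.
    rewrite (@entryM1 _ char0 j) => [|l nl]; last by rewrite (D1_offdiag char0 Da) ?mulr0.
    case: (eqVneq i j) => [->|nij]; first exact: mulrC.
    by rewrite !(D1_offdiag char0 _ nij) ?mulr0 ?mul0r.
  + split; [apply: (cen_not_left_noetherian char0) |
      apply: (cen_not_right_noetherian char0)] => n; exact: e_diag_cen.
  + exact: cen_evH_not_finitely_generated.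
  + exact: cen_evH_not_domain.
- split.
  + rewrite hE; apply: (cen_evH_D1 char0).
      by apply: (nonscalar_size char0); rewrite size_XsubC.
    move=> i j nij; rewrite !hornerXsubC (inj_eq (addIr _)).
    by apply: contraNneq nij => /(natf_inj char0)[->].
  + move=> D1h; move: e10; rewrite -D1h => D10.
    have /eqP := D1_offdiag char0 (i := 1%N) (j := 0%N) D10 isT.
    by rewrite entry_e // oner_eq0.
split; [exact: finite_dim_Cen_F | exact: cen_der | exact: cen_int | exact: cen_x].
Qed.
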